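(* Suppose that the sequence $\{\mathbf{z}^k\}_{k\in\mathbb{N}}$ generated by the SGSN algorithm is bounded and that $F=h+g$ is a P{\L}K function. Then $\{\mathbf{z}^k\}_{k\in\mathbb{N}}$ converges to a P-stationary point of the problem $\min_{\mathbf{z}\in\mathbb{R}^m}F(\mathbf{z})$.
   Context: Setting: $f:\mathbb{R}^n\to\mathbb{R}$ is $\sigma_f$-strongly convex ($\sigma_f>0$, possibly nonsmooth), $A\in\mathbb{R}^{m\times n}$, $\mathbf{b}\in\mathbb{R}^m$, $\mu>0$. $\|\cdot\|$ is the Euclidean norm of a vector and the Frobenius norm of a matrix. $f^*$ is the conjugate of $f$ (differentiable with $\frac1{\sigma_f}$-Lipschitz gradient). $h(\mathbf{z})=f^*(-A^\top\mathbf{z})-\langle\mathbf{b},\mathbf{z}\rangle$ is convex with $\ell_h$-Lipschitz gradient, $\ell_h=\|A\|^2/\sigma_f$. $g(\mathbf{z})=\mu\|\mathbf{z}\|_0+\delta_+(\mathbf{z})$, where $\|\mathbf{z}\|_0$ counts nonzero entries and $\delta_+(\mathbf{z})=0$ if $\mathbf{z}\ge0$, $+\infty$ otherwise. $F=h+g$. For $\tau>0$, $\mathrm{Prox}_{\tau g(\cdot)}(\mathbf{u})=\arg\min_{\mathbf{z}}\{g(\mathbf{z})+\frac1{2\tau}\|\mathbf{z}-\mathbf{u}\|^2\}$ (a set). $\mathbf{z}^*$ is a P-stationary point of $\min F$ if there is $\tau>0$ with $\mathbf{z}^*\in\mathrm{Prox}_{\tau g(\cdot)}(\mathbf{z}^*-\tau\nabla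 h(\mathbf{z}^* ))$. Subdifferentials: $\widehat\partial\varphi(\bar{\mathbf{z}})=\{\mathbf{v}:\liminf_{\mathbf{z}\to\bar{\mathbf{z}},\mathbf{z}\ne\bar{\mathbf{z}}}\frac{\varphi(\mathbf{z})-\varphi(\bar{\mathbf{z}})-\langle\mathbf{v},\mathbf{z}-\bar{\mathbf{z}}\rangle}{\|\mathbf{z}-\bar{\mathbf{z}}\|}\ge0\}$ for $\varphi(\bar{\mathbf{z}})<\infty$; limiting subdifferential $\partial\varphi(\bar{\mathbf{z}})=\{\mathbf{v}:\exists\,\mathbf{z}^k\to\bar{\mathbf{z}},\ \varphi(\mathbf{z}^k)\to\varphi(\bar{\mathbf{z}}),\ \widehat\partial\varphi(\mathbf{z}^k)\ni\mathbf{v}^k\to\mathbf{v}\}$ (empty where $\varphi=\infty$). P{\L}K function: for $s\in(0,+\infty]$ let $\Psi_s$ be the class of concave continuous $\psi:[0,s)\to\mathbb{R}_+$ with $\psi(0)=0$, $\psi$ continuously differentiable on $(0,s)$, and $\psi'>0$ on $(0,s)$. A proper l.s.c. $\varphi$ has the P{\L}K property at $\bar{\mathbf{z}}\in\mathrm{dom}\,\partial\varphi=\{\mathbf{z}:\partial\varphi(\mathbf{z})\neq\varnothing\}$ if there are $s\in(0,+\infty]$, a neighborhood $\mathcal{N}(\bar{\mathbf{z}})$ and $\psi\in\Psi_s$ with $\psi'(\varphi(\mathbf{z})-\varphi(\bar{\mathbf{z}}))\,\mathrm{dist}(0,\partial\varphi(\mathbf{z}))\ge1$ for all $\mathbf{z}\in\mathcal{N}(\bar{\mathbf{z}})$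 with $\varphi(\bar{\mathbf{z}})<\varphi(\mathbf{z})<\varphi(\bar{\mathbf{z}})+s$. $\varphi$ is a P{\L}K function if this holds at every point of $\mathrm{dom}\,\partial\varphi$. Generalized Hessians: for a locally Lipschitz $\Phi$, $\partial_C\Phi(\bar{\mathbf{z}})$ is the convex hull of all limits of Jacobians $J\Phi(\mathbf{z}^k)$ along sequences of differentiability points $\mathbf{z}^k\to\bar{\mathbf{z}}$. $\partial^2 f^*:=\partial_C(\nabla f^* )$ and $\widehat\partial^2h(\mathbf{z}):=\{AQA^\top: Q\in\partial^2f^*(-A^\top\mathbf{z})\}$. Index notation: for $T\subset\{1,\dots,m\}$, $\overline{T}$ is its complement, $\mathbf{z}_T$ the subvector, $H_T$ the submatrix with rows and columns in $T$, $\nabla_Th(\mathbf{z})=(\nabla h(\mathbf{z}))_T$. SGSN algorithm: fix $\tau\in(0,1/\ell_h)$, $c_1,c_2,\gamma>0$, and $\mathbf{z}^0\in\mathbb{R}^m$. For $k=0,1,\dots$: (1) $T_k:=\{i:[\mathbf{z}^k-\tau\nabla h(\mathbf{z}^k)]_i>\sqrt{2\tau\mu}\}$; $\mathbf{v}^k_{T_k}=[\mathbf{z}^k-\tau\nabla h(\mathbf{z}^k)]_{T_k}$, $\mathbf{v}^k_{\overline{T}_k}=0$. (2) $\gamma_k:=\gamma\|\nabla_{T_k}h(\mathbf{v}^k)\|$; choose $H^k\in\widehat\partial^2h(\mathbf{v}^k)$; let $\mathbf{d}^k_{T_k}$ solve $(H^k_{T_k}+\gamma_kI)\mathbf{d}^k_{T_k}=-\nabla_{T_k}h(\mathbf{v}^k)$;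 set $\widetilde{\mathbf{z}}^{k+1}_{T_k}=\mathbf{v}^k_{T_k}+\alpha_k\mathbf{d}^k_{T_k}$, $\widetilde{\mathbf{z}}^{k+1}_{\overline{T}_k}=0$, where $\alpha_k=\min\{1,\beta_k\}$ with $\beta_k=1$ if $\mathbf{d}^k_{T_k}\ge0$ and $\beta_k=\min\{-v^k_i/d^k_i:i\in T_k,\ d^k_i<0\}$ otherwise. (3) $\mathbf{z}^{k+1}=\widetilde{\mathbf{z}}^{k+1}$ if both $F(\mathbf{v}^k)-F(\widetilde{\mathbf{z}}^{k+1})\ge c_1\|\widetilde{\mathbf{z}}^{k+1}-\mathbf{v}^k\|^2$ and $\|\nabla_{T_k}h(\widetilde{\mathbf{z}}^{k+1})\|\le c_2\|\widetilde{\mathbf{z}}^{k+1}-\mathbf{v}^k\|$ hold; otherwise $\mathbf{z}^{k+1}=\mathbf{v}^k$. *)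

(* Defs.v *)
From HB Require Import structures.
From mathcomp Require Import all_boot all_order all_algebra.
From mathcomp Require Import all_classical all_reals all_analysis.

Set Implicit Arguments.
Unset Strict Implicit.
Unset Printing Implicit Defensive.

Import Order.TTheory GRing.Theory Num.Theory.
Import numFieldNormedType.Exports.

Local Open Scope classical_set_scope.
Local Open Scope ring_scope.

(* Vectors of R^n are row vectors 'rV[R]_n, the type on which the library
   defines Jacobians. With a matrix A : 'M_(m, n), the vector A^T z is
   therefore written z *m A. Limits and derivatives refer to the library's
   sup norm on matrices, which induces the same topology and differentiability
   as [enorm]; all quantitative conditions use [enorm]. *)

Section Euclid.
Context {R : realType}.

(* Frobenius norm; it is the Euclidean norm when p = 1. *)
Definition enorm {p n : nat} (M : 'M[R]_(p, n)) : R :=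
  Num.sqrt (\sum_i \sum_j M i j ^+ 2).

Definition dot {n : nat} (u v : 'rV[R]_n) : R := \sum_i u 0 i * v 0 i.

Definition strongly_convex {n : nat} (sigma : R) (f : 'rV[R]_n -> R) : Prop :=
  forall (x y : 'rV[R]_n) (t : R), 0 <= t <= 1 ->
    f (t *: x + (1 - t) *: y) <=
      t * f x + (1 - t) * f y - sigma / 2 * t * (1 - t) * enorm (x - y) ^+ 2.

(* The real-valued [sup] is the intended supremum only when the set is bounded
   above; this holds for every y when f is strongly convex on all of R^n. *)
Definition conjugate {n : nat} (f : 'rV[R]_n -> R) (y : 'rV[R]_n) : R :=
  sup [set dot x y - f x | x in [set: 'rV[R]_n]].

Definition gradient {n : nat} (phi : 'rV[R]_n -> R) (x : 'rV[R]_n) : 'rV[R]_n :=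
  \row_i 'D_(delta_mx 0 i) phi x.

End Euclid.

Section Subdifferentials.
Context {R : realType} {n : nat}.
Implicit Types (phi : 'rV[R]_n -> \bar R) (z : 'rV[R]_n).

Definition frechet_subdiff phi z : set 'rV[R]_n :=
  [set v | (phi z < +oo)%E /\
    (0 <= limf_einf (fun w =>
            (phi w - phi z - (dot v (w - z))%:E) * ((enorm (w - z))^-1)%:E)
          z^')%E].

Definition limiting_subdiff phi z : set 'rV[R]_n :=
  [set v | (phi z < +oo)%E /\
    exists zs vs : nat -> 'rV[R]_n,
      [/\ zs @ \oo --> z,
          (fun k => phi (zs k)) @ \oo --> phi z,
          forall k, frechet_subdiff phi (zs k) (vs k)
        & vs @ \oo --> v]].

Definition dist0 (S : set 'rV[R]_n) : \bar R :=
  ereal_inf [set (enorm v)%:E | v in S].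

End Subdifferentials.

Section PLK.
Context {R : realType}.

(* Functions on [0, s) are represented by total functions R -> R, only the
   values on [0, s) being constrained. *)
Definition desingularizing (s : \bar R) (psi : R -> R) : Prop :=
  let D := [set t : R | 0 <= t /\ (t%:E < s)%E] in
  [/\ convex_function (D : set (convex_lmodType R^o)) (fun t => - psi t),
      {within D, continuous psi},
      forall t, D t -> 0 <= psi t,
      psi 0 = 0
    & forall t, 0 < t -> (t%:E < s)%E ->
        [/\ derivable psi t 1, {for t, continuous (derive1 psi)} & 0 < derive1 psi t]].

Definition PLK_at {n : nat} (phi : 'rV[R]_n -> \bar R) (zbar : 'rV[R]_n) : Prop :=
  exists (s : \bar R) (psi : R -> R),
    [/\ (0 < s)%E, desingularizing s psi
      & \forall z \near zbar,
          (phi zbar < phi z)%E -> (phi z < phi zbar + s)%E ->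
          (1 <= (derive1 psi (fine (phi z - phi zbar)))%:E
                * dist0 (limiting_subdiff phi z))%E].

Definition PLK_function {n : nat} (phi : 'rV[R]_n -> \bar R) : Prop :=
  forall zbar, limiting_subdiff phi zbar !=set0 -> PLK_at phi zbar.

End PLK.

Section GeneralizedHessian.
Context {R : realType}.

Definition convex_hull (E : lmodType R) (S : set E) : set E :=
  smallest (@convex_set R E) S.

(* The library's 'J acts on row vectors from the right, so its transpose is the
   usual Jacobian matrix. *)
Definition clarke_jacobian {n p : nat} (Phi : 'rV[R]_n -> 'rV[R]_p)
    (z : 'rV[R]_n) : set 'M[R]_(p, n) :=
  convex_hull [set J : 'M[R]_(p, n) | exists zs : nat -> 'rV[R]_n,
    [/\ zs @ \oo --> z, forall k, differentiable Phi (zs k)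
      & (fun k => ('J Phi (zs k))^T) @ \oo --> J]].

Definition hess_h {m n : nat} (f : 'rV[R]_n -> R) (A : 'M[R]_(m, n))
    (z : 'rV[R]_m) : set 'M[R]_m :=
  [set A *m Q *m A^T |
     Q in clarke_jacobian (gradient (conjugate f)) (- (z *m A))].

End GeneralizedHessian.

Section Problem.
Context {R : realType} {m n : nat}.
Implicit Types (f : 'rV[R]_n -> R) (A : 'M[R]_(m, n)) (b z u : 'rV[R]_m).

Definition h_fun f A b z : R := conjugate f (- (z *m A)) - dot b z.

Definition l0norm z : nat := #|[set i | z 0 i != 0]%SET|.

Definition delta_plus z : \bar R :=
  if [forall i, 0 <= z 0 i] then 0%E else +oo%E.

Definition g_fun (mu : R) z : \bar R := ((mu * (l0norm z)%:R)%:E + delta_plus z)%E.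

Definition F_fun f A b (mu : R) z : \bar R := ((h_fun f A b z)%:E + g_fun mu z)%E.

Definition prox (tau : R) (g : 'rV[R]_m -> \bar R) u : set 'rV[R]_m :=
  [set z | forall w,
     (g z + ((2 * tau)^-1 * enorm (z - u) ^+ 2)%:E <=
      g w + ((2 * tau)^-1 * enorm (w - u) ^+ 2)%:E)%E].

Definition P_stationary f A b (mu : R) z : Prop :=
  exists2 tau : R, 0 < tau &
    prox tau (g_fun mu) (z - tau *: gradient (h_fun f A b) z) z.

End Problem.

Section SGSN.
Context {R : realType} {m : nat}.
Implicit Types (T : {set 'I_m}) (u v d : 'rV[R]_m).

Definition subvec T u : 'rV[R]_#|T| := \row_j u 0 (enum_val j).

Definition submat T (H : 'M[R]_m) : 'M[R]_#|T| :=
  \matrix_(i, j) H (enum_val i) (enum_val j).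

Definition zero_outside T u : 'rV[R]_m := \row_i (if i \in T then u 0 i else 0).

(* In the [else] branch the set is finite and nonempty, so [inf] is its
   minimum. *)
Definition beta_step T v d : R :=
  if [forall i in T, 0 <= d 0 i] then 1
  else inf [set - v 0 i / d 0 i | i in [set i : 'I_m | i \in T /\ d 0 i < 0]].

Definition alpha_step T v d : R := Num.min 1 (beta_step T v d).

(* [z'] may follow the iterate [z]. The components of [d] outside [T] play no
   role; the linear system is stated in columns. *)
Definition SGSN_step {n : nat} (f : 'rV[R]_n -> R) (A : 'M[R]_(m, n))
    (b : 'rV[R]_m) (mu tau c1 c2 gamma : R) (z z' : 'rV[R]_m) : Prop :=
  let F := F_fun f A b mu in
  let dh := gradient (h_fun f A b) in
  let u := z - tau *: dh z in
  let T := [set i | Num.sqrt (2 * tau * mu) < u 0 i]%SET in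
  let v := zero_outside T u in
  let gammak := gamma * enorm (subvec T (dh v)) in
  exists (H : 'M[R]_m) (d : 'rV[R]_m),
    [/\ hess_h f A v H,
        (submat T H + gammak%:M) *m (subvec T d)^T = - (subvec T (dh v))^T
      & let zt := zero_outside T (v + alpha_step T v d *: d) in
        z' = if ((c1 * enorm (zt - v) ^+ 2)%:E <= F v - F zt)%E &&
                (enorm (subvec T (dh zt)) <= c2 * enorm (zt - v))
             then zt else v].

End SGSN.

(* Main.v *)
(* The objective F is the sum of h, which is convex with Lipschitz gradient because f is
   strongly convex, and of the l0-penalty g on the nonnegative orthant. The proximal
   point v = Prox(z - tau grad h(z)) decreases F by a multiple of |v - z|^2, and both
   outcomes of the safeguard decrease it further by c1 |z' - v|^2. Since the support of
   z' lies in the active set, grad h(z') restricted to the support of z' is a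
   subgradient of F at z' of size O(|v - z| + |z' - v|). The nonzero entries of v
   exceed sqrt(2 tau mu), so supports stabilize near an accumulation point and F
   converges to its value there. The PLK inequality then gives the usual finite-length
   argument. *)
Require Import Defs.
From HB Require Import structures.
From mathcomp Require Import all_boot all_order all_algebra.
From mathcomp Require Import all_classical all_reals all_analysis.
From mathcomp Require Import ring lra.
Import Order.TTheory GRing.Theory Num.Theory.
Import numFieldNormedType.Exports.
Local Open Scope classical_set_scope.
Local Open Scope ring_scope.

(** The conjugate enters through two inequalities only: convexity, and the reverse inequality up to
    a quadratic term. Both pull back through [A] and yield directional derivatives, their linearity
    and the quadratic upper bound, with no maximizer of the conjugate and no calculus along
    segments. Two defects of [F] shape the rest. [F] may be infinite at the initial point, so the
    argument runs on the sequence shifted by one, which is feasible. And [F] is discontinuous, so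
    closeness of an iterate to [w] controls neither its support nor its value; the gap in the
    entries of proximal points does, and so an accumulation point is asked to attract the iterates
    and their proximal points at the same indices. In the length estimate the subgradient at an
    iterate is bounded by the step before it, while the decrease measures the step after it. *)

Section EuclideanGeometry.
Context {R : realType}.

(** * Dot product and Euclidean norm *)

Lemma enorm_ge0 p n (M : 'M[R]_(p, n)) : 0 <= enorm M.
Proof. exact: sqrtr_ge0. Qed.

Lemma sqr_enorm p n (M : 'M[R]_(p, n)) :
  enorm M ^+ 2 = \sum_i \sum_j M i j ^+ 2.
Proof.
by rewrite sqr_sqrtr//; do 2!(apply: sumr_ge0 => ? _); exact: sqr_ge0.
Qed.

Context {n : nat}.
Implicit Types u v w : 'rV[R]_n.

Lemma dotvv u : dot u u = enorm u ^+ 2.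
Proof.
by rewrite sqr_enorm big_ord1; apply: eq_bigr => i _; rewrite expr2.
Qed.

Lemma dotC u v : dot u v = dot v u.
Proof. by apply: eq_bigr => i _; rewrite mulrC. Qed.

Lemma dotDl u v w : dot (u + v) w = dot u w + dot v w.
Proof. by rewrite -big_split; apply: eq_bigr => i _; rewrite mxE mulrDl. Qed.

Lemma dotZl a u w : dot (a *: u) w = a * dot u w.
Proof. by rewrite mulr_sumr; apply: eq_bigr => i _; rewrite mxE mulrA. Qed.

Lemma dotNl u w : dot (- u) w = - dot u w.
Proof. by rewrite -scaleN1r dotZl mulN1r. Qed.

Lemma dotBl u v w : dot (u - v) w = dot u w - dot v w.
Proof. by rewrite dotDl dotNl. Qed.

Lemma dotDr u v w : dot w (u + v) = dot w u + dot w v.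
Proof. by rewrite dotC dotDl !(dotC w). Qed.

Lemma dotZr a u w : dot w (a *: u) = a * dot w u.
Proof. by rewrite dotC dotZl dotC. Qed.

Lemma dotNr u w : dot w (- u) = - dot w u.
Proof. by rewrite dotC dotNl dotC. Qed.

Lemma dotBr u v w : dot w (u - v) = dot w u - dot w v.
Proof. by rewrite dotDr dotNr. Qed.

Lemma enorm_eq0 u : (enorm u == 0) = (u == 0).
Proof.
apply/eqP/eqP => [u0|->]; last first.
  by apply/eqP; rewrite -sqrf_eq0 -dotvv -(scale0r 0) dotZl mul0r.
apply/rowP => i; rewrite mxE; apply/eqP; rewrite -sqrf_eq0.
have : \sum_j u 0 j ^+ 2 == 0.
  by have := sqr_enorm _ _ u; rewrite u0 expr0n big_ord1 => <-.
by rewrite psumr_eq0 => [/allP/(_ i)/implyP|j _]; rewrite ?mem_index_enum ?sqr_ge0//; apply.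
Qed.

Lemma cauchy_schwarz u v : dot u v <= enorm u * enorm v.
Proof.
have [->|v0] := eqVneq v 0.
  by rewrite -(scale0r 0) dotZr mul0r mulr_ge0// enorm_ge0.
have c0 : 0 < enorm v by rewrite lt_def enorm_eq0 v0 enorm_ge0.
apply: le_trans (ler_norm _) _.
rewrite -(@ler_pXn2r _ 2) ?nnegrE ?mulr_ge0 ?enorm_ge0//.
rewrite real_normK ?num_real// exprMn.
(* This square expands to |v|^2 (|u|^2 |v|^2 - <u,v>^2). *)
have : 0 <= enorm (enorm v ^+ 2 *: u - dot u v *: v) ^+ 2 by exact: sqr_ge0.
rewrite -dotvv dotBl !dotBr !dotZl !dotZr (dotC v u) !dotvv.
have := exprn_gt0 2 c0; move: (enorm v ^+ 2) (enorm u ^+ 2) (dot u v).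
move=> c a d c0' H; rewrite -subr_ge0 -(pmulr_rge0 _ c0'); lra.
Qed.

Lemma sqr_enormD u v :
  enorm (u + v) ^+ 2 = enorm u ^+ 2 + 2 * dot u v + enorm v ^+ 2.
Proof. by rewrite -!dotvv !dotDl !dotDr (dotC v u); ring. Qed.

Lemma ler_enormD u v : enorm (u + v) <= enorm u + enorm v.
Proof.
rewrite -(@ler_pXn2r _ 2) ?nnegrE ?addr_ge0 ?enorm_ge0//.
by rewrite sqr_enormD; have := cauchy_schwarz u v; lra.
Qed.

Lemma enormZ a u : enorm (a *: u) = `|a| * enorm u.
Proof.
apply/eqP; rewrite -(@eqrXn2 _ 2) ?mulr_ge0 ?enorm_ge0//.
by rewrite exprMn real_normK ?num_real// -!dotvv dotZl dotZr mulrA -expr2.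
Qed.

Lemma enormN u : enorm (- u) = enorm u.
Proof. by rewrite -scaleN1r enormZ normrN1 mul1r. Qed.

Lemma sqr_enormD_le u v :
  enorm (u + v) ^+ 2 <= 2 * (enorm u ^+ 2 + enorm v ^+ 2).
Proof.
have := sqr_ge0 (enorm (u - v)).
by rewrite (sqr_enormD u (- v)) (sqr_enormD u v) dotNr enormN; lra.
Qed.

Lemma enormB u v : enorm (u - v) = enorm (v - u).
Proof. by rewrite -enormN opprB. Qed.

Lemma ler_enorm_coord u i : `|u 0 i| <= enorm u.
Proof.
rewrite -(@ler_pXn2r _ 2) ?nnegrE ?enorm_ge0//.
rewrite sqr_enorm big_ord1 (bigD1 i)//= real_normK ?num_real// lerDl.
by apply: sumr_ge0 => j _; exact: sqr_ge0.
Qed.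

Lemma ler_enorm_coordB u v i : `|u 0 i - v 0 i| <= enorm (u - v).
Proof. by have := ler_enorm_coord (u - v) i; rewrite !mxE. Qed.

Lemma ler_enorm_sum u : enorm u <= \sum_i `|u 0 i|.
Proof.
have h : 0 <= \sum_i `|u 0 i| by apply: sumr_ge0.
rewrite -(@ler_pXn2r _ 2) ?nnegrE ?enorm_ge0// sqr_enorm big_ord1.
rewrite expr2 mulr_suml; apply: ler_sum => i _.
rewrite -real_normK ?num_real// expr2 ler_wpM2l//.
by rewrite (bigD1 i)//= lerDl sumr_ge0.
Qed.

End EuclideanGeometry.

(** Cauchy-Schwarz on each column of [A]; the squared column norms add up to the squared Frobenius
    norm. *)
Lemma enorm_mulmx (R : realType) m n (A : 'M[R]_(m, n)) (z : 'rV[R]_m) :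
  enorm (z *m A) <= enorm z * enorm A.
Proof.
rewrite -(@ler_pXn2r _ 2) ?nnegrE ?mulr_ge0 ?enorm_ge0//.
rewrite exprMn sqr_enorm big_ord1 (sqr_enorm _ _ A) exchange_big/=.
rewrite mulr_sumr; apply: ler_sum => j _; rewrite mxE.
pose c := (col j A)^T.
have -> : \sum_i z 0 i * A i j = dot z c by apply: eq_bigr => i _; rewrite !mxE.
have -> : \sum_i A i j ^+ 2 = enorm c ^+ 2.
  by rewrite sqr_enorm big_ord1; apply: eq_bigr => i _; rewrite !mxE.
rewrite -exprMn -real_normK ?num_real//.
rewrite (@ler_pXn2r _ 2) ?nnegrE ?mulr_ge0 ?enorm_ge0// ler_norml.
by rewrite cauchy_schwarz lerNl -dotNr -(enormN c) cauchy_schwarz.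
Qed.

(** * The conjugate of a strongly convex function *)

Section Conjugate.
Context {R : realType} {n : nat}.
Implicit Types x y u : 'rV[R]_n.

(** Induction on the number of coordinates allowed to be nonzero. The radius is quantified inside
    the induction because each step doubles it. *)
Lemma convex_bounded_box (f : 'rV[R]_n -> R) (r : R) :
  (forall x y (t : R), 0 <= t <= 1 ->
     f (t *: x + (1 - t) *: y) <= t * f x + (1 - t) * f y) ->
  exists B, forall x, (forall i, `|x 0 i| <= r) -> f x <= B.
Proof.
move=> fconv.
suff bnd k : (k <= n)%N -> forall r, 0 < r ->
    exists B, forall x, (forall i, `|x 0 i| <= r) ->
    (forall i : 'I_n, (k <= i)%N -> x 0 i = 0) -> f x <= B.
  have [//||B BP] := bnd n _ (`|r| + 1); first by rewrite ltr_wpDl.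
  exists B => x xr; apply: BP => [i|i]; last by rewrite leqNgt ltn_ord.
  by rewrite (le_trans (xr i))// (le_trans (ler_norm r))// lerDl.
elim: k => [_ s _|k IH kn s s0].
  exists (f 0) => x _ x0; rewrite (_ : x = 0)//.
  by apply/rowP => i; rewrite mxE x0.
have [B BP] := IH (ltnW kn) (2 * s) ltac:(lra).
pose k' := Ordinal kn; pose e : 'rV[R]_n := delta_mx 0 k'.
pose C := `|f ((2 * s) *: e)| + `|f (- (2 * s) *: e)|.
exists (2^-1 * B + 2^-1 * C) => x xs x0.
have xk := xs k'; set a := x 0 k' in xk.
have a_s : - s <= a <= s by rewrite -ler_norml.
(* Midpoint of a point with coordinate [k] erased, covered by the induction hypothesis, and a point
   of the segment between the two points [2 s e] and [- 2 s e]. *)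
have -> : x = 2^-1 *: (2 *: (x - a *: e)) + (1 - 2^-1) *: ((2 * a) *: e).
  rewrite scalerA mulVf// scale1r scalerA -[1 - _]/(1 - 2^-1).
  by have -> : (1 - 2^-1) * (2 * a) = a by [lra]; rewrite subrK.
apply: le_trans (fconv _ _ _ _) _; first lra.
have -> : 1 - 2^-1 = 2^-1 :> R by lra.
rewrite lerD// ler_pM2l//.
- apply: BP => i; rewrite !mxE ?eqxx/=.
    rewrite normrM ger0_norm// ler_pM2l//.
    have [->|] := eqVneq i k'; first by rewrite mulr1 subrr normr0 ltW.
    by rewrite mulr0 subr0.
  move=> ki; have [->|ik] := eqVneq i k'; first by rewrite mulr1 subrr mulr0.
  rewrite mulr0 subr0 x0 ?mulr0// ltn_neqAle ki andbT.
  by apply: contra ik => /eqP ki'; apply/eqP/val_inj.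
- pose t := (a + s) / (2 * s).
  have t01 : 0 <= t <= 1.
    by rewrite /t divr_ge0 ?ler_pdivrMr/=; lra.
  have -> : (2 * a) *: e = t *: ((2 * s) *: e) + (1 - t) *: (- (2 * s) *: e).
    by rewrite !scalerA -scalerDl; congr (_ *: _); rewrite /t; field; lra.
  apply: le_trans (fconv _ _ _ t01) _.
  have H1 := ler_norm (f ((2 * s) *: e)); have H2 := ler_norm (f (- (2 * s) *: e)).
  have G1 := normr_ge0 (f ((2 * s) *: e)); have G2 := normr_ge0 (f (- (2 * s) *: e)).
  rewrite /C; set p := `|_| in H1 G1 *; set q := `|_| in H2 G2 *.
  have t0 : 0 <= t by case/andP: t01.
  have t1 : t <= 1 by case/andP: t01.
  have : t * f ((2 * s) *: e) <= t * p by rewrite ler_wpM2l.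
  have : (1 - t) * f (- (2 * s) *: e) <= (1 - t) * q by rewrite ler_wpM2l// subr_ge0.
  nra.
Qed.

Context {sigma : R} {f : 'rV[R]_n -> R}.
Hypotheses (sigma_gt0 : 0 < sigma) (f_sc : strongly_convex sigma f).

(** The bound [B] on the unit box stands in for a subgradient at 0: strong convexity is applied to 0
    as a point between [x] and an opposite point [u] of that box. *)
Lemma strongly_convex_coercive :
  exists B, forall x, f 0 + (1 + enorm x) * (f 0 - B) + sigma / 2 * enorm x ^+ 2 <= f x.
Proof.
have s_gt0 := sigma_gt0.
have [|B BP] := @convex_bounded_box f 1.
  move=> x y t t01; apply: le_trans (f_sc x y _ t01) _.
  rewrite gerBl mulr_ge0 ?sqr_ge0// !mulr_ge0// ?(ltW sigma_gt0)//; lra.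
exists B => x; have N0 := enorm_ge0 _ _ x; set N := enorm x in N0 *.
(* Chosen so that [t x + (1 - t) u = 0]; dividing by [1 + N] instead of [N] covers [x = 0]. *)
pose u := - (1 + N)^-1 *: x; pose t := (2 + N)^-1.
have t01 : 0 <= t <= 1 by apply/andP; split; rewrite /t ?invr_ge0 ?invf_le1; lra.
have fu : f u <= B.
  apply: BP => i; rewrite mxE normrM normrN (@gtr0_norm _ (1 + N)^-1);
    last by rewrite invr_gt0; lra.
  rewrite mulrC ler_pdivrMr; last lra.
  by have := ler_enorm_coord x i; rewrite -/N; lra.
have := f_sc x u _ t01.
have -> : t *: x + (1 - t) *: u = 0.
  rewrite /u scalerA -scalerDl; apply/eqP; rewrite scaler_eq0; apply/orP; left.
  by apply/eqP; rewrite /t; field; lra.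
have -> : x - u = ((2 + N) / (1 + N)) *: x.
  rewrite -[X in X - _]scale1r -scalerBl; congr (_ *: _); field; lra.
rewrite enormZ exprMn real_normK ?num_real// -/N.
have -> : sigma / 2 * t * (1 - t) * (((2 + N) / (1 + N)) ^+ 2 * N ^+ 2) =
   sigma / 2 * N ^+ 2 / (1 + N) by rewrite /t; field; lra.
have -> : t * f x + (1 - t) * f u - sigma / 2 * N ^+ 2 / (1 + N) =
  (f x + (1 + N) * f u - sigma / 2 * N ^+ 2 * (2 + N) / (1 + N)) / (2 + N).
  by rewrite /t; field; lra.
rewrite ler_pdivlMr; last lra.
have S0 : 0 <= sigma / 2 * N ^+ 2 by rewrite mulr_ge0 ?sqr_ge0// divr_ge0// ltW.
set S := sigma / 2 * N ^+ 2 in S0 *.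
have : S <= S * (2 + N) / (1 + N).
  by rewrite ler_pdivlMr; [apply: ler_wpM2l; lra | lra].
nra.
Qed.

(** Quadratic growth of [f] beats the linear term, so the real [sup] in [conjugate] is a genuine
    supremum. [K] is the total linear coefficient, and the bound comes from maximizing
    [K N - sigma / 2 N^2] over [N]. *)
Lemma conjugate_has_sup y :
  has_sup [set dot x y - f x | x in [set: 'rV[R]_n]].
Proof.
have s_gt0 := sigma_gt0.
split; first by exists (dot 0 y - f 0), 0.
have [B BP] := strongly_convex_coercive.
pose K := enorm y - f 0 + B.
exists (- f 0 + B - f 0 + K ^+ 2 / (2 * sigma)) => _ [x _ <-].
have CS := cauchy_schwarz x y; have Bx := BP x.
set N := enorm x in CS Bx.
suff : K * N - sigma / 2 * N ^+ 2 <= K ^+ 2 / (2 * sigma).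
  by rewrite /K; nra.
rewrite -subr_ge0.
have -> : K ^+ 2 / (2 * sigma) - (K * N - sigma / 2 * N ^+ 2) =
  (K - sigma * N) ^+ 2 / (2 * sigma) by field; lra.
by rewrite divr_ge0 ?sqr_ge0//; lra.
Qed.

Lemma fenchel_young x y : dot x y - f x <= conjugate f y.
Proof. by apply: (sup_upper_bound (conjugate_has_sup y)); exists x. Qed.

Lemma conjugate_le y M :
  (forall x, dot x y - f x <= M) -> conjugate f y <= M.
Proof.
by move=> le_M; apply: ge_sup => [|_ [x _ <-]//]; exists (dot 0 y - f 0), 0.
Qed.

Lemma conjugate_convex y1 y2 t : 0 <= t <= 1 ->
  conjugate f (t *: y1 + (1 - t) *: y2) <=
    t * conjugate f y1 + (1 - t) * conjugate f y2.
Proof.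
move=> /andP[t0 t1]; apply: conjugate_le => x; rewrite dotDr !dotZr.
have := fenchel_young x y1; have := fenchel_young x y2; nra.
Qed.

(* Strong convexity of [f] at the near-maximizers [x1] and [x2], combined with
   the identity [t<x1,y1> + (1-t)<x2,y2> = <x,y> + t(1-t)<x1-x2,y1-y2>] at the
   convex combinations [x] and [y]. *)
Lemma conjugate_semiconcave y1 y2 t : 0 <= t <= 1 ->
  t * conjugate f y1 + (1 - t) * conjugate f y2 <=
    conjugate f (t *: y1 + (1 - t) *: y2)
    + sigma^-1 / 2 * t * (1 - t) * enorm (y1 - y2) ^+ 2.
Proof.
have s_gt0 := sigma_gt0.
move=> t01; apply/ler_addgt0Pr => e e0.
have [_ [x1 _ <-] x1e] := sup_adherent e0 (conjugate_has_sup y1).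
have [_ [x2 _ <-] x2e] := sup_adherent e0 (conjugate_has_sup y2).
rewrite -!/(conjugate f _) in x1e x2e.
have fx := f_sc x1 x2 _ t01.
have := fenchel_young (t *: x1 + (1 - t) *: x2) (t *: y1 + (1 - t) *: y2).
set cy := conjugate f (t *: y1 + _); set xx := f (t *: x1 + _) in fx *.
have CS : dot (x1 - x2) (y1 - y2) <=
    sigma / 2 * enorm (x1 - x2) ^+ 2 + sigma^-1 / 2 * enorm (y1 - y2) ^+ 2.
  apply: le_trans (cauchy_schwarz _ _) _; rewrite -subr_ge0.
  set p := enorm _; set q := enorm _.
  have -> : sigma / 2 * p ^+ 2 + sigma^-1 / 2 * q ^+ 2 - p * q =
     (sigma * p - q) ^+ 2 / (2 * sigma) by field; lra.
  by rewrite divr_ge0 ?sqr_ge0//; lra.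
have tt : 0 <= t * (1 - t) by case/andP: t01 => ? ?; apply: mulr_ge0; lra.
have := ler_wpM2l tt CS.
rewrite !(dotBl, dotBr, dotDl, dotDr, dotZl, dotZr).
case/andP: t01 => t0 t1.
have : t * (conjugate f y1 - e) <= t * (dot x1 y1 - f x1) by apply: ler_wpM2l => //; exact: ltW.
have : (1 - t) * (conjugate f y2 - e) <= (1 - t) * (dot x2 y2 - f x2).
  by apply: ler_wpM2l; [lra | exact: ltW].
lra.
Qed.

Lemma h_fun_convex m (A : 'M[R]_(m, n)) b (z1 z2 : 'rV[R]_m) t : 0 <= t <= 1 ->
  h_fun f A b (t *: z1 + (1 - t) *: z2) <=
    t * h_fun f A b z1 + (1 - t) * h_fun f A b z2.
Proof.
move=> t01; rewrite /h_fun mulmxDl -!scalemxAl opprD -!scalerN dotDr !dotZr.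
have := conjugate_convex (- (z1 *m A)) (- (z2 *m A)) _ t01; lra.
Qed.

Lemma h_fun_semiconcave m (A : 'M[R]_(m, n)) b (z1 z2 : 'rV[R]_m) t :
  0 <= t <= 1 ->
  t * h_fun f A b z1 + (1 - t) * h_fun f A b z2 <=
    h_fun f A b (t *: z1 + (1 - t) *: z2)
    + (enorm A ^+ 2 / sigma) / 2 * t * (1 - t) * enorm (z1 - z2) ^+ 2.
Proof.
have s_gt0 := sigma_gt0.
move=> t01; rewrite /h_fun mulmxDl -!scalemxAl opprD -!scalerN dotDr !dotZr.
have := conjugate_semiconcave (- (z1 *m A)) (- (z2 *m A)) _ t01.
rewrite -opprD -mulmxBl enormN.
have Az : enorm ((z1 - z2) *m A) ^+ 2 <= enorm A ^+ 2 * enorm (z1 - z2) ^+ 2.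
  by rewrite -exprMn mulrC ler_pXn2r ?nnegrE ?mulr_ge0 ?enorm_ge0// enorm_mulmx.
have k0 : 0 <= sigma^-1 / 2 * t * (1 - t).
  by case/andP: t01 => t0 t1; rewrite !mulr_ge0 ?invr_ge0//; lra.
have := ler_wpM2l k0 Az; rewrite [_ / sigma]mulrC.
by move: (sigma^-1) => s; lra.
Qed.

End Conjugate.

(** The passage [t -> 0], used to discard the error terms of difference quotients. *)
Lemma ler_of_linear_excess (R : realType) (a b c : R) :
  (forall t : R, 0 < t <= 1 -> a <= b + c * t) -> a <= b.
Proof.
move=> abc; apply/ler_addgt0Pr => e e0.
have c0 : 0 < `|c| + 1 by rewrite ltr_wpDl.
pose t := Num.min 1 (e / (`|c| + 1)).
have t0 : 0 < t by rewrite /t lt_min ltr01 divr_gt0.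
have te : (`|c| + 1) * t <= e.
  by rewrite mulrC -ler_pdivlMr// /t ge_min lexx orbT.
have t01 : 0 < t <= 1 by rewrite t0 /t ge_min lexx.
apply: le_trans (abc _ t01) _; rewrite lerD2l; apply: le_trans te.
by rewrite ler_pM2r// (le_trans (ler_norm c))// lerDl.
Qed.

(** * Differentiability and quadratic bounds from convexity and semiconcavity *)

Section SmoothConvex.
Context {R : realType} {m : nat} {h : 'rV[R]_m -> R} {L : R}.
Implicit Types z w d e : 'rV[R]_m.
Hypothesis L_ge0 : 0 <= L.
Hypothesis h_conv : forall z w (t : R), 0 <= t <= 1 ->
  h (t *: z + (1 - t) *: w) <= t * h z + (1 - t) * h w.
Hypothesis h_semi : forall z w (t : R), 0 <= t <= 1 ->
  t * h z + (1 - t) * h w <=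
    h (t *: z + (1 - t) *: w) + L / 2 * t * (1 - t) * enorm (z - w) ^+ 2.

Let q z d t : R := t^-1 * (h (z + t *: d) - h z).

Lemma midpoint_semiconcave z w :
  h z + h w <= 2 * h (2^-1 *: (z + w)) + L / 4 * enorm (z - w) ^+ 2.
Proof.
have := @h_semi z w 2^-1 ltac:(lra).
have e2 : 1 - 2^-1 = 2^-1 :> R by lra.
by rewrite e2 (scalerDr _ z w); lra.
Qed.

Lemma midpoint_convex z w : 2 * h (2^-1 *: (z + w)) <= h z + h w.
Proof.
have := @h_conv z w 2^-1 ltac:(lra).
have e2 : 1 - 2^-1 = 2^-1 :> R by lra.
by rewrite e2 (scalerDr _ z w); lra.
Qed.

(** Convexity at [z], which lies between [z - t d] and [z + s d] with weights [s / (s + t)] and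
    [t / (s + t)]. *)
Lemma left_slope_le z d s t : 0 < s -> 0 < t -> q z d (- t) <= q z d s.
Proof.
move=> s0 t0.
have st : 0 <= s / (s + t) <= 1 by rewrite divr_ge0 ?ler_pdivrMr; lra.
have := h_conv (z + - t *: d) (z + s *: d) _ st.
have -> : s / (s + t) *: (z + - t *: d) + (1 - s / (s + t)) *: (z + s *: d) = z.
  rewrite !scalerDr !scalerA addrACA -!scalerDl.
  have -> : s / (s + t) + (1 - s / (s + t)) = 1 by ring.
  have -> : s / (s + t) * - t + (1 - s / (s + t)) * s = 0 by field; lra.
  by rewrite scale1r scale0r addr0.
rewrite /q; move: (h z) (h (z + - t *: d)) (h (z + s *: d)) => a x y H.
have {}H : (s + t) * a <= s * x + t * y.
  have -> : s * x + t * y = (s + t) * (s / (s + t) * x + (1 - s / (s + t)) * y).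
    by field; lra.
  by rewrite ler_pM2l//; lra.
rewrite -subr_ge0.
have -> : s^-1 * (y - a) - (- t)^-1 * (x - a) =
  (s * x + t * y - (s + t) * a) / (s * t) by field; lra.
by rewrite divr_ge0 ?mulr_ge0; lra.
Qed.

(** Semiconcavity at the midpoint [z] closes the gap between right and left slopes up to [O(t)],
    which forces the one-sided derivatives to agree. *)
Lemma right_slope_le z d t : 0 < t ->
  q z d t <= q z d (- t) + L * t * enorm d ^+ 2.
Proof.
move=> t0; have := midpoint_semiconcave (z + t *: d) (z + - t *: d).
have -> : 2^-1 *: (z + t *: d + (z + - t *: d)) = z.
  rewrite addrACA -scalerDl subrr scale0r addr0 -[X in X + X]scale1r -scalerDl scalerA.
  by rewrite mulVf ?scale1r.
have -> : z + t *: d - (z + - t *: d) = (2 * t) *: d.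
  rewrite opprD addrACA subrr add0r -scaleNr opprK -scalerDl; congr (_ *: _); ring.
rewrite enormZ exprMn real_normK ?num_real// /q.
move: (h z) (h (z + - t *: d)) (h (z + t *: d)) (enorm d ^+ 2) => a x y N H.
rewrite -subr_ge0.
have -> : (- t)^-1 * (x - a) + L * t * N - t^-1 * (y - a) =
  (2 * a + L / 4 * ((2 * t) ^+ 2 * N) - (y + x)) / t by field; lra.
by rewrite divr_ge0; lra.
Qed.

(** The supremum of the left slopes separates left from right slopes, and these are [O(t)] apart; it
    is therefore the derivative, with an explicit rate. *)
Lemma derive_approx z d t : t != 0 ->
  `|q z d t - 'D_d h z| <= L * enorm d ^+ 2 * `|t|.
Proof.
pose S := [set q z d (- t) | t in [set t : R | 0 < t]].
have S1 : S (q z d (- 1)) by exists 1 => //=; exact: ltr01.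
have ubS s : 0 < s -> ubound S (q z d s).
  by move=> s0 _ [r r0 <-]; exact: left_slope_le.
have S_sup : has_sup S by split; [exists (q z d (-1)) | exists (q z d 1); exact: ubS].
have approx s : s != 0 -> `|q z d s - sup S| <= L * enorm d ^+ 2 * `|s|.
  suff pos r : 0 < r -> sup S - L * enorm d ^+ 2 * r <= q z d (- r) <= sup S /\
                        sup S <= q z d r <= sup S + L * enorm d ^+ 2 * r.
    case: (ltgtP 0 s) => // [s0|s0] _.
      by have [_ /andP[? ?]] := pos _ s0; rewrite ger0_norm ?gtr0_norm//; lra.
    have [/andP[]] := pos (- s) ltac:(lra); rewrite opprK => ? ? _.
    by rewrite ler0_norm ?ltr0_norm//; lra.
  move=> r0; have up := right_slope_le z d _ r0.
  have Sr : q z d (- r) <= sup S by apply: sup_upper_bound => //; exists r.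
  have rS : sup S <= q z d r by apply: ge_sup; [exists (q z d (-1))|exact: ubS].
  by split; apply/andP; split=> //; lra.
suff -> : 'D_d h z = sup S by exact: approx.
apply: cvg_lim => //; apply/cvgrPdist_le => e e0; near=> s.
have s0 : s != 0 by near: s; exact: nbhs_dnbhs_neq.
rewrite distrC /= [s *: d + z]addrC; apply: le_trans (approx _ s0) _.
have se : `|s| < e / (L * enorm d ^+ 2 + 1).
  near: s; apply: dnbhs0_lt; apply: divr_gt0 => //.
  by rewrite ltr_wpDl// mulr_ge0 ?sqr_ge0.
move: se; rewrite ltr_pdivlMr; last by rewrite ltr_wpDl// mulr_ge0 ?sqr_ge0.
by have := normr_ge0 s; rewrite mulrDr mulr1; lra.
Unshelve. all: by end_near. Qed.

(** Since [z + t (d + e)] is the midpoint of [z + 2 t d] and [z + 2 t e], convexity and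
    semiconcavity make the quotients additive up to [O(t)]. [C] collects the three approximation
    errors and the semiconcavity defect. *)
Lemma deriveD_direction z d e : 'D_(d + e) h z = 'D_d h z + 'D_e h z.
Proof.
pose C := L * (enorm (d + e) ^+ 2 + 2 * enorm d ^+ 2 + 2 * enorm e ^+ 2
               + enorm (d - e) ^+ 2).
suff bnd (t : R) : 0 < t <= 1 -> `|'D_(d + e) h z - ('D_d h z + 'D_e h z)| <= 0 + C * t.
  have := ler_of_linear_excess _ _ _ _ bnd; rewrite normr_le0 subr_eq0.
  by move/eqP.
move=> /andP[t0 t1].
have := derive_approx z (d + e) t ltac:(lra).
have := derive_approx z d (2 * t) ltac:(lra).
have := derive_approx z e (2 * t) ltac:(lra).
have tt : 0 < 2 * t by lra.
rewrite !ler_norml !gtr0_norm//.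
have := midpoint_convex (z + (2 * t) *: d) (z + (2 * t) *: e).
have := midpoint_semiconcave (z + (2 * t) *: d) (z + (2 * t) *: e).
have -> : 2^-1 *: (z + (2 * t) *: d + (z + (2 * t) *: e)) = z + t *: (d + e).
  rewrite addrACA -(scalerDr _ d e) -{1 2}[z]scale1r -(scalerDl z).
  rewrite (scalerDr 2^-1) !scalerA.
  by rewrite mulrA mulVf ?mul1r ?scale1r.
have -> : z + (2 * t) *: d - (z + (2 * t) *: e) = (2 * t) *: (d - e).
  by rewrite opprD addrACA subrr add0r -scalerBr.
rewrite enormZ gtr0_norm// exprMn /q /C.
move: (h z) (h (z + (2 * t) *: d)) (h (z + (2 * t) *: e)) (h (z + t *: (d + e))).
move=> a x y w H1 H2.
have {H1} : (2 * t)^-1 * (x - a) + (2 * t)^-1 * (y - a) - t^-1 * (w - a) <=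
    L / 2 * enorm (d - e) ^+ 2 * t.
  rewrite -subr_ge0.
  have -> : L / 2 * enorm (d - e) ^+ 2 * t - ((2 * t)^-1 * (x - a)
     + (2 * t)^-1 * (y - a) - t^-1 * (w - a)) =
    (2 * w + L / 4 * ((2 * t) ^+ 2 * enorm (d - e) ^+ 2) - (x + y)) / (2 * t).
    by field; lra.
  by rewrite divr_ge0; lra.
have {H2} : t^-1 * (w - a) <= (2 * t)^-1 * (x - a) + (2 * t)^-1 * (y - a).
  rewrite -subr_ge0.
  have -> : (2 * t)^-1 * (x - a) + (2 * t)^-1 * (y - a) - t^-1 * (w - a) =
    (x + y - 2 * w) / (2 * t) by field; lra.
  by rewrite divr_ge0; lra.
have : 0 <= L * enorm (d - e) ^+ 2 * t by exact: mulr_ge0 (mulr_ge0 L_ge0 (sqr_ge0 _)) (ltW t0).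
lra.
Qed.

Lemma deriveZ_direction z d a : 'D_(a *: d) h z = a * 'D_d h z.
Proof.
have [->|a0] := eqVneq a 0.
  rewrite scale0r mul0r; apply: (@addrI _ ('D_0 h z)).
  by rewrite -deriveD_direction !addr0.
pose C := 2 * (L * a ^+ 2 * enorm d ^+ 2).
suff bnd (t : R) : 0 < t <= 1 -> `|'D_(a *: d) h z - a * 'D_d h z| <= 0 + C * t.
  have := ler_of_linear_excess _ _ _ _ bnd; rewrite normr_le0 subr_eq0.
  by move/eqP.
move=> /andP[t0 t1].
have A1 := derive_approx z (a *: d) t ltac:(lra).
have A2 : `|a| * `|q z d (t * a) - 'D_d h z| <= `|a| * (L * enorm d ^+ 2 * `|t * a|).
  by rewrite ler_wpM2l// derive_approx// mulf_neq0//; lra.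
have qE : q z (a *: d) t = a * q z d (t * a).
  by rewrite /q scalerA; field; rewrite a0 gt_eqF.
rewrite -normrM mulrBr -qE in A2.
have -> : 0 + C * t = L * enorm (a *: d) ^+ 2 * `|t|
                   + `|a| * (L * enorm d ^+ 2 * `|t * a|).
  rewrite enormZ exprMn normrM (gtr0_norm t0) /C.
  have -> : a ^+ 2 = `|a| ^+ 2 by rewrite real_normK ?num_real.
  by ring.
by apply: le_trans (lerD A1 A2); rewrite distrC -[X in X <= _]normrN;
  apply: le_trans (ler_normB _ _); rewrite normrN le_eqVlt; apply/orP; left;
  apply/eqP; congr `|_|; ring.
Qed.

Lemma deriveE_gradient z d : 'D_d h z = dot (gradient h z) d.
Proof.
have D0 : 'D_0 h z = 0 by rewrite -[X in 'D_X h z](scale0r 0) deriveZ_direction mul0r.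
rewrite {1}(row_sum_delta d).
rewrite (big_morph (fun e => 'D_e h z) (deriveD_direction z) D0).
by apply: eq_bigr => i _; rewrite deriveZ_direction mxE mulrC.
Qed.

(** Along the segment, convexity bounds the difference quotient by [h w - h z] and semiconcavity
    bounds it from the other side up to [L / 2 |w - z|^2]; then [t -> 0]. *)
Lemma smooth_convex_bounds z w :
  0 <= h w - h z - dot (gradient h z) (w - z) <= L / 2 * enorm (w - z) ^+ 2.
Proof.
rewrite -deriveE_gradient; set d := w - z; set N := enorm d ^+ 2.
have N0 : 0 <= N by exact: sqr_ge0.
have seg t : t *: w + (1 - t) *: z = z + t *: d.
  by rewrite /d scalerBl scale1r scalerBr addrCA.
apply/andP; split.
- rewrite subr_ge0; apply: (ler_of_linear_excess _ _ _ (L * N)) => t /andP[t0 t1].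
  have := derive_approx z d t ltac:(lra); rewrite ler_norml gtr0_norm// => /andP[+ _].
  have := @h_conv w z t ltac:(lra); rewrite seg => H.
  have : q z d t <= h w - h z by rewrite /q mulrC ler_pdivrMr//; lra.
  by rewrite -/N; lra.
- rewrite lerBlDr.
  apply: (ler_of_linear_excess _ _ _ (L * N)) => t /andP[t0 t1].
  have := derive_approx z d t ltac:(lra); rewrite ler_norml gtr0_norm// => /andP[_ +].
  have := @h_semi w z t ltac:(lra); rewrite seg -/d -/N => H.
  have : h w - h z <= q z d t + L / 2 * N.
    rewrite -lerBlDr /q [t^-1 * _]mulrC ler_pdivlMr//.
    have : 0 <= L / 2 * t ^+ 2 * N
      by apply: mulr_ge0 N0; apply: mulr_ge0 (sqr_ge0 _); exact: divr_ge0.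
    by rewrite expr2; lra.
  by rewrite -/N; lra.
Qed.

End SmoothConvex.

(** * Convergence in the Euclidean norm and the finite-length principle *)

Section EuclideanTopology.
Context {R : realType} {m : nat}.
Implicit Types (w y : 'rV[R]_m) (z : nat -> 'rV[R]_m).

Lemma nbhs_enormP w (P : set 'rV[R]_m) :
  nbhs w P <-> exists2 e : R, 0 < e & forall y, enorm (y - w) < e -> P y.
Proof.
split=> [/nbhs_ballP[e e0 eP]|[e e0 eP]].
  exists e => // y ywe; apply: eP; split=> // i j; rewrite ord1 /ball/= distrC.
  by apply: le_lt_trans ywe; have := ler_enorm_coord (y - w) j; rewrite !mxE.
(* With [m.+1] the radius also makes sense for [m = 0], and the sum of [m] terms stays strictly
   below [e]. *)
apply/nbhs_ballP; exists (e / m.+1%:R) => [|y [_ wy]]; first exact: divr_gt0.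
apply: eP; apply: le_lt_trans (ler_enorm_sum _) _.
apply: (@le_lt_trans _ _ (\sum_(i < m) e / m.+1%:R)).
  apply: ler_sum => i _; rewrite !mxE distrC ltW//; exact: wy.
rewrite sumr_const card_ord -[X in X < _]mulr_natr mulrAC ltr_pdivrMr ?ltr0n//.
by rewrite ltr_pM2l// ltr_nat.
Qed.

Lemma cvg_enormP z w :
  z @ \oo --> w <->
  forall e : R, 0 < e -> exists N, forall k, (N <= k)%N -> enorm (z k - w) < e.
Proof.
split=> [zw e e0|zw P /nbhs_enormP[e e0 eP]].
  have /zw[N _ NP] : nbhs w [set y | enorm (y - w) < e].
    by apply/nbhs_enormP; exists e.
  by exists N.
by have [N NP] := zw _ e0; exists N => // k /= Nk; apply/eP/NP.
Qed.

Lemma cvg_seq_distP (u : nat -> R) (l : R) :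
  u @ \oo --> l <->
  forall e : R, 0 < e -> exists N, forall k, (N <= k)%N -> `|u k - l| < e.
Proof.
split=> [ul e e0|ul]; last first.
  apply/cvgrPdist_lt => e e0; have [N NP] := ul e e0.
  by exists N => // k /= /NP; rewrite distrC.
have /cvgrPdist_lt/(_ _ e0)[N _ NP] := ul.
by exists N => k /NP; rewrite distrC.
Qed.

Lemma bounded_cluster z (M : R) : (forall k, enorm (z k) <= M) ->
  exists w, forall e : R, 0 < e ->
    forall N, exists2 k, (N <= k)%N & enorm (z k - w) < e.
Proof.
move=> zM; have cpt : compact [set v : 'rV[R]_m | forall i, v ord0 i \in `[- M, M]].
  apply: (@rV_compact _ _ (fun=> `[- M, M]%classic)) => _.
  exact: segment_compact.
have [|w [_ zw]] := cpt (z @ \oo) _.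
  exists 0%N => // k _ i; rewrite in_itv/= -ler_norml.
  exact: le_trans (ler_enorm_coord _ _) (zM k).
exists w => e e0 N.
have [] := zw [set x | exists2 k, (N <= k)%N & x = z k] [set y | enorm (y - w) < e].
- by exists N => // k Nk; exists k.
- by apply/nbhs_enormP; exists e.
- by move=> _ [[k Nk ->] ?]; exists k.
Qed.

(* The quantity [V k = |z k.+1 - w| + Delta k + c * phi k.+1] decreases as long
   as [z] stays in the ball, hence [z] never leaves it. *)
Lemma cvg_of_finite_length z w (Delta phi : nat -> R) (c rho : R) (K : nat) :
    0 < c -> 0 < rho ->
    (forall e : R, 0 < e -> forall N, exists2 k, (N <= k)%N & enorm (z k - w) < e) ->
    (forall k, enorm (z k.+1 - z k) <= Delta k) ->
    (forall k, 0 <= phi k) -> Delta @ \oo --> 0 -> phi @ \oo --> 0 ->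
    (forall k, (K <= k)%N -> enorm (z k.+1 - w) < rho ->
       phi k.+2 <= phi k.+1 /\ Delta k.+1 ^+ 2 <= c * Delta k * (phi k.+1 - phi k.+2)) ->
  z @ \oo --> w.
Proof.
move=> c0 rho0 clus step phi0 Dcvg phicvg kl; apply/cvg_enormP => e' e'0.
have D0 k : 0 <= Delta k by apply: le_trans (step k); exact: enorm_ge0.
(* Trapping the sequence in balls of every small radius gives convergence at once, without summing
   lengths; the cap [rho] keeps the recursion available. *)
pose e := Num.min e' rho.
have e0 : 0 < e by rewrite lt_min e'0.
have [N1 N1P] := (cvg_seq_distP _ _).1 Dcvg (e / 3) ltac:(by rewrite divr_gt0).
have [N2 N2P] := (cvg_seq_distP _ _).1 phicvg (e / 3 / c) ltac:(by rewrite !divr_gt0).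
have [[//|k] Nk zk] := clus (e / 3) ltac:(by rewrite divr_gt0) (maxn K (maxn N1 N2)).+1.
move: Nk; rewrite ltnS !geq_max => /and3P[Kk N1k N2k].
pose V k := enorm (z k.+1 - w) + Delta k + c * phi k.+1.
have Vk : V k < e.
  have := N1P _ N1k; rewrite subr0 ger0_norm// => ?.
  have := N2P _ (leqW N2k); rewrite subr0 ger0_norm// ltr_pdivlMr// => ?.
  by rewrite /V; lra.
have Vlt j : V (k + j)%N < e.
  elim: j => [|j IH]; first by rewrite addn0.
  rewrite addnS; move: (k + j)%N (leq_trans Kk (leq_addr j k)) IH => l Kl Vl.
  apply: le_lt_trans (Vl).
  have := step l.+1; have := ler_enormD (z l.+2 - z l.+1) (z l.+1 - w).
  rewrite addrA subrK /V => H1 H2.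
  have zl : enorm (z l.+1 - w) < rho.
    have : V l < rho by apply: lt_le_trans Vl _; rewrite /e ge_min lexx orbT.
    have cp : 0 <= c * phi l.+1 by apply: mulr_ge0 => //; exact: ltW.
    by rewrite /V; have := D0 l; lra.
  have [pl H] := kl l Kl zl.
  (* Arithmetic-geometric mean inequality applied to the recursion. One [Delta l.+1] pays for the
     move of [z], the other is the new term of [V]. *)
  suff : 2 * Delta l.+1 <= Delta l + c * (phi l.+1 - phi l.+2) by lra.
  have cp : 0 <= c * (phi l.+1 - phi l.+2) by rewrite mulr_ge0 ?subr_ge0// ltW.
  rewrite -(@ler_pXn2r _ 2) ?nnegrE ?mulr_ge0 ?addr_ge0//.
  have := sqr_ge0 (Delta l - c * (phi l.+1 - phi l.+2)); lra.
exists k.+1 => -[//|l]; rewrite ltnS => /subnKC <-.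
have := Vlt (l - k)%N; rewrite /V => Vl.
have cp : 0 <= c * phi (k + (l - k)).+1 by apply: mulr_ge0 => //; exact: ltW.
have : e <= e' by rewrite /e ge_min lexx.
have := D0 (k + (l - k))%N; lra.
Qed.

End EuclideanTopology.

(** * Desingularizing functions *)

Section Desingularizing.
Context {R : realType} {s : \bar R} {psi : R -> R}.
Hypothesis psiD : desingularizing s psi.

(** By concavity the chord from [b] to [a] is at least as steep as shorter chords ending at [a],
    whose slopes tend to the derivative. Only the derivative at [a] occurs, so [b = 0] is
    allowed. *)
Lemma desingularizing_tangent (a b : R) : 0 <= b -> b < a -> (a%:E < s)%E ->
  psi^`()%classic a * (a - b) <= psi a - psi b.
Proof.
move=> b0 ba a_s; have a0 : 0 < a by exact: le_lt_trans ba.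
case: psiD => psi_conc _ _ _ /(_ _ a0 a_s)[psi_der _ _].
have Db : [set t : R | 0 <= t /\ (t%:E < s)%E] b.
  by split=> //; apply: lt_trans a_s; rewrite lte_fin.
have Da : [set t : R | 0 <= t /\ (t%:E < s)%E] a by split=> //; exact: ltW.
suff : psi^`()%classic a <= (psi a - psi b) / (a - b).
  by rewrite ler_pdivlMr// subr_gt0.
rewrite derive1E.
apply: (cvgr_to_le (cvg_dnbhs_at_left psi_der)).
near=> x.
have x0 : x < 0 by near: x; exact: nbhs_left_lt.
have xab : b - a < x by near: x; apply: nbhs_left_gt; rewrite subr_lt0.
rewrite /= [x *: _]mulr1.
pose t := x / (b - a).
have t0 : 0 <= t by rewrite /t -mulrNN -invrN divr_ge0; lra.
have t1 : t <= 1 by rewrite /t -mulrNN -invrN ler_pdivrMr; lra.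
have : - psi (t * b + (1 - t) * a) <= t * - psi b + (1 - t) * - psi a.
  exact: psi_conc (Itv01 t0 t1) b a (mem_set Db) (mem_set Da).
have -> : t * b + (1 - t) * a = x + a by rewrite /t; field; lra.
move=> H; rewrite /GRing.scale/= mulrC ler_ndivrMr// mulrAC ler_pdivrMr ?subr_gt0//.
have tx : t * (b - a) = x by rewrite /t; field; lra.
have ab : 0 <= a - b by lra.
by have := ler_wpM2r ab H; rewrite -tx; lra.
Unshelve. all: by end_near. Qed.

Lemma desingularizing_nondecreasing (a b : R) : 0 <= b -> b <= a -> (a%:E < s)%E ->
  psi b <= psi a.
Proof.
move=> b0; rewrite le_eqVlt => /orP[/eqP->//|ba] a_s.
have a0 : 0 < a by exact: le_lt_trans ba.
case: psiD => _ _ _ _ /(_ _ a0 a_s)[_ _ d0].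
rewrite -subr_ge0; apply: le_trans (desingularizing_tangent _ _ b0 ba a_s).
by rewrite mulr_ge0 ?subr_ge0 ?ltW.
Qed.

Lemma desingularizing_cvg0 (u : nat -> R) : (0 < s)%E ->
  (forall k, 0 <= u k) -> (forall k, ((u k)%:E < s)%E) -> u @ \oo --> 0 ->
  psi \o u @ \oo --> 0.
Proof.
move=> s0 u0 us ucvg; case: psiD => _ psi_cont _ psi00 _.
set D := [set t : R | _] in psi_cont.
have D0 : D 0 by split.
rewrite -[X in _ --> X]psi00.
have /subspace_continuousP/(_ _ D0) psi0 := psi_cont.
apply: cvg_comp psi0 => P [/= e e0 eP].
have [N _ NP] := ucvg _ (nbhsx_ballx _ _ e0).
by exists N => // k /NP/eP; apply; split.
Qed.

End Desingularizing.

(** * Hard thresholding and subgradients of the composite objective *)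

Section CompositeObjective.
Context {R : realType} {m : nat}.
Implicit Types (u v w y z p : 'rV[R]_m) (mu tau : R).

Definition nonneg z := forall i, 0 <= z 0 i.

Lemma l0normE z : (l0norm z)%:R = \sum_i (z 0 i != 0)%:R :> R.
Proof.
rewrite /l0norm -sum1_card natr_sum big_mkcond/=.
by apply: eq_bigr => i _; rewrite inE; case: eqP.
Qed.

Lemma g_fun_fin mu z : nonneg z -> g_fun mu z = (mu * (l0norm z)%:R)%:E.
Proof. by move=> z0; rewrite /g_fun /delta_plus ifT ?adde0//; apply/forallP. Qed.

Lemma g_fun_pinfty mu z : ~ nonneg z -> g_fun mu z = +oo%E.
Proof.
move=> z0; rewrite /g_fun /delta_plus ifF ?addey//.
by apply/negbTE/negP => /forallP.
Qed.

(** The scalar proximal problem multiplied by [2 tau], so that a nonzero entry costs [th^2]. Both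
    alternatives include the tie [a = th]: limits of thresholded points only satisfy weak
    inequalities. *)
Lemma hard_threshold_coord (th a b x : R) : 0 < th -> 0 <= b ->
  x = 0 /\ a <= th \/ x = a /\ th <= a ->
  th ^+ 2 * (x != 0)%:R + (x - a) ^+ 2 <= th ^+ 2 * (b != 0)%:R + (b - a) ^+ 2.
Proof.
move=> th0 b0 [] [-> ath].
  rewrite eqxx mulr0 add0r.
  have [->|bn0] := eqVneq b 0; first by rewrite lerDr mulr0.
  rewrite mulr1; have [a0|a0] := leP 0 a.
    by have := sqr_ge0 (b - a); nra.
  by have := sqr_ge0 th; nra.
rewrite (gt_eqF (lt_le_trans th0 ath)) mulr1 subrr.
have [->|bn0] := eqVneq b 0; last by rewrite mulr1 expr0n lerD2l sqr_ge0.
rewrite mulr0 expr0n/= addr0 !add0r sqrrN ler_pXn2r// nnegrE ltW//.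
exact: lt_le_trans ath.
Qed.

Lemma prox_hard_threshold mu tau u z : 0 < mu -> 0 < tau ->
  (forall i, z 0 i = 0 /\ u 0 i <= Num.sqrt (2 * tau * mu) \/
             z 0 i = u 0 i /\ Num.sqrt (2 * tau * mu) <= u 0 i) ->
  prox tau (g_fun mu) u z.
Proof.
move=> mu0 tau0; set th := Num.sqrt _ => zu.
have tm0 : 0 < 2 * tau * mu by rewrite !mulr_gt0.
have th0 : 0 < th by rewrite sqrtr_gt0.
have th2 : th ^+ 2 = 2 * tau * mu by rewrite sqr_sqrtr// ltW.
have z0 : nonneg z.
  move=> i; case: (zu i) => -[-> //] /(lt_le_trans th0); exact: ltW.
move=> w /=; case: (pselect (nonneg w)) => [w0|w0]; last first.
  by rewrite (g_fun_pinfty _ _ w0) addye// leey.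
rewrite !g_fun_fin// -!EFinD lee_fin !l0normE !sqr_enorm !big_ord1 !mulr_sumr.
rewrite -!big_split; apply: ler_sum => i _ /=; rewrite !mxE.
have k0 : 0 < (2 * tau)^-1 by rewrite invr_gt0; lra.
have kE c d : mu * c + (2 * tau)^-1 * d = (2 * tau)^-1 * (th ^+ 2 * c + d).
  by rewrite th2; field; lra.
rewrite !kE ler_pM2l//; exact: hard_threshold_coord.
Qed.

Section WithSmoothPart.
Context {h : 'rV[R]_m -> R} {G : 'rV[R]_m -> 'rV[R]_m} {L mu : R}.
Hypotheses (L_gt0 : 0 < L) (mu_gt0 : 0 < mu).
Hypothesis smooth : forall z w,
  0 <= h w - h z - dot (G z) (w - z) <= L / 2 * enorm (w - z) ^+ 2.

(** The value at [z + e] is bounded below by linearization at [z] and above by the quadratic bound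
    at [w]; the step [e] along the gradient difference turns this into an estimate of [|D|^2]. The
    constant need not be sharp. *)
Lemma gradient_lipschitz z w : enorm (G z - G w) <= 2 * L * enorm (z - w).
Proof.
have L0 := L_gt0.
rewrite -(@ler_pXn2r _ 2) ?nnegrE ?mulr_ge0 ?enorm_ge0//; last lra.
pose D := G z - G w; pose e := (2 * L)^-1 *: D.
have /andP[A1 _] := smooth z (z + e); have /andP[A2 _] := smooth w z.
have /andP[_ A3] := smooth w (z + e).
have H : dot D e <= L / 2 * enorm (z + e - w) ^+ 2.
  rewrite /D dotBl; move: A1 A2 A3; rewrite [z + e - z]addrAC subrr add0r.
  by rewrite -[z + e - w]addrA [e - w]addrC addrA [dot (G w) (_ + e)]dotDr; lra.
have {}H : (2 * L)^-1 * enorm D ^+ 2 <=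
    L * (enorm (z - w) ^+ 2 + (2 * L)^-2 * enorm D ^+ 2).
  rewrite /e dotZr dotvv in H; apply: le_trans H _.
  have -> : z + (2 * L)^-1 *: D - w = (z - w) + (2 * L)^-1 *: D.
    by rewrite addrAC.
  rewrite -mulrA ler_pM2l//.
  set x := z - w; set y := (2 * L)^-1 *: D.
  have -> : (2 * L)^-2 * enorm D ^+ 2 = enorm y ^+ 2.
    by rewrite enormZ [RHS]exprMn real_normK ?num_real// exprVn.
  by have := sqr_enormD_le x y; lra.
rewrite -/D -subr_ge0.
have -> : (2 * L * enorm (z - w)) ^+ 2 - enorm D ^+ 2 = 4 * L *
  (L * (enorm (z - w) ^+ 2 + (2 * L)^-2 * enorm D ^+ 2)
   - (2 * L)^-1 * enorm D ^+ 2).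
  by field; lra.
by rewrite mulr_ge0 ?subr_ge0//; lra.
Qed.

Lemma smooth_dist z w :
  `|h w - h z| <= enorm (G z) * enorm (w - z) + L / 2 * enorm (w - z) ^+ 2.
Proof.
have := smooth z w; have := cauchy_schwarz (G z) (w - z).
have := cauchy_schwarz (- G z) (w - z); rewrite enormN dotNl ler_norml => ? ? ?.
have := sqr_ge0 (enorm (w - z)); have L0 := L_gt0; nra.
Qed.

(** The real values of [F], correct on the nonnegative orthant only. *)
Definition objective z : R := h z + mu * (l0norm z)%:R.
Definition ereal_objective z : \bar R := ((h z)%:E + g_fun mu z)%E.

Lemma ereal_objective_fin z : nonneg z -> ereal_objective z = (objective z)%:E.
Proof. by move=> z0; rewrite /ereal_objective g_fun_fin. Qed.

Lemma ereal_objective_pinfty z : ~ nonneg z -> ereal_objective z = +oo%E.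
Proof. by move=> z0; rewrite /ereal_objective g_fun_pinfty// addey. Qed.

(* Near [w] the l0-norm can only grow, and it jumps by [mu] as soon as a zero
   entry becomes nonzero, which dominates any linear term in that entry. *)
Lemma frechet_subdiff_objective w p : nonneg w ->
  (forall i, w 0 i != 0 -> p 0 i = G w 0 i) ->
  frechet_subdiff ereal_objective w p.
Proof.
have mu0 := mu_gt0; move=> w0 pG; split; first by rewrite ereal_objective_fin// ltry.
rewrite limf_einfE.
(* On zero entries the radius keeps the linear term below [mu]; on positive entries it keeps [y]
   nonzero. *)
pose dlt i := if w 0 i == 0 then mu / (1 + `|p 0 i - G w 0 i|) else w 0 i.
have dlt0 i : 0 < dlt i.
  rewrite /dlt; case: eqVneq => [_|wi]; first by rewrite divr_gt0// ltr_pwDl.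
  by rewrite lt_def wi w0.
pose V := [set y : 'rV[R]_m | forall i, `|y 0 i - w 0 i| < dlt i].
have Vw : nbhs w V.
  apply/nbhs_enormP; exists (\big[Num.min/1]_i dlt i).
    by apply: lt_bigmin.
  move=> y yw i; apply: (@lt_le_trans _ _ (\big[Num.min/1]_j dlt j)); last exact: bigmin_le.
  by apply: le_lt_trans yw; have := ler_enorm_coord (y - w) i; rewrite !mxE.
apply: (@le_trans _ _ (ereal_inf ((fun y => ((ereal_objective y
  - ereal_objective w - (dot p (y - w))%:E) * ((enorm (y - w))^-1)%:E)%E) @` V))); last first.
  apply: ereal_sup_ubound; exists V => //; exact: nbhs_dnbhs.
apply: le_ereal_inf_tmp => _ [y Vy <-].
apply: mule_ge0; last by rewrite lee_fin invr_ge0 enorm_ge0.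
rewrite (ereal_objective_fin _ w0).
case: (pselect (nonneg y)) => [y0|y0]; last first.
  by rewrite (ereal_objective_pinfty _ y0) -EFinN addye// addye// leey.
rewrite (ereal_objective_fin _ y0) -!EFinB lee_fin /objective.
have /andP[H _] := smooth w y.
suff : 0 <= mu * (l0norm y)%:R - mu * (l0norm w)%:R + dot (G w - p) (y - w).
  by rewrite dotBl; lra.
rewrite !l0normE !mulr_sumr -sumrB -big_split; apply: sumr_ge0 => i _ /=.
rewrite !mxE; have := Vy i; rewrite /dlt.
case: eqVneq => [wi|wi] Vi.
  rewrite wi subr0 in Vi *; rewrite mulr0 subr0.
  have [->|yi] := eqVneq (y 0 i) 0; first by rewrite !mulr0 addr0.
  rewrite mulr1; move: Vi; rewrite ltr_pdivlMr ?ltr_pwDl// => Vi.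
  have : - ((G w 0 i - p 0 i) * y 0 i) <= `|y 0 i| * `|p 0 i - G w 0 i|.
    by rewrite -mulNr opprB mulrC -normrM ler_norm.
  have := normr_ge0 (y 0 i); lra.
have wp : 0 < w 0 i by rewrite lt_def wi w0.
have yi : y 0 i != 0.
  by apply: contraTneq Vi => ->; rewrite sub0r normrN ger0_norm ?ltxx// ltW.
by rewrite yi mulr1 subrr (pG _ wi) subrr mul0r addr0.
Qed.

Lemma frechet_sub_limiting (phi : 'rV[R]_m -> \bar R) w :
  frechet_subdiff phi w `<=` limiting_subdiff phi w.
Proof.
move=> p wp; split; first by case: wp.
by exists (fun=> w), (fun=> p); split=> //; exact: cvg_cst.
Qed.

Lemma dist0_objective w p : nonneg w ->
  (forall i, w 0 i != 0 -> p 0 i = G w 0 i) ->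
  (dist0 (limiting_subdiff ereal_objective w) <= (enorm p)%:E)%E.
Proof.
move=> w0 pG; apply: ereal_inf_lbound; exists p => //.
exact/frechet_sub_limiting/frechet_subdiff_objective.
Qed.

(** The feasible point [z] is a competitor in the proximal problem; the common gradient term cancels
    and the quadratic upper bound replaces the linearization of [h]. *)
Lemma prox_sufficient_decrease tau z v : 0 < tau -> nonneg z -> nonneg v ->
  prox tau (g_fun mu) (z - tau *: G z) v ->
  objective v + (tau^-1 - L) / 2 * enorm (v - z) ^+ 2 <= objective z.
Proof.
move=> tau0 z0 v0 /(_ z); rewrite !g_fun_fin// -!EFinD lee_fin /objective.
have -> : v - (z - tau *: G z) = (v - z) + tau *: G z by rewrite opprB addrA addrAC.
have -> : z - (z - tau *: G z) = tau *: G z by rewrite opprB addrC subrK.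
rewrite sqr_enormD dotZr (dotC _ (G z)).
have /andP[_ H] := smooth z v.
set N := enorm (v - z) ^+ 2 in H *; set d := dot _ _ in H *.
set E := enorm _ ^+ 2.
have -> : (2 * tau)^-1 * (N + 2 * (tau * d) + E) =
  tau^-1 / 2 * N + d + (2 * tau)^-1 * E by field; lra.
lra.
Qed.

End WithSmoothPart.
End CompositeObjective.

(** * Safeguarded proximal gradient steps *)

Section GradientProjection.
Context {R : realType} {m : nat}.
Context {h : 'rV[R]_m -> R} {G : 'rV[R]_m -> 'rV[R]_m} {L mu tau c1 c2 : R}.
Hypotheses (L_gt0 : 0 < L) (mu_gt0 : 0 < mu) (tau_gt0 : 0 < tau).
Hypotheses (tauL : L < tau^-1) (c1_gt0 : 0 < c1) (c2_gt0 : 0 < c2).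
Hypothesis smooth : forall z w : 'rV[R]_m,
  0 <= h w - h z - dot (G z) (w - z) <= L / 2 * enorm (w - z) ^+ 2.
Implicit Types (u v w y z p : 'rV[R]_m).

Let theta := Num.sqrt (2 * tau * mu).
Let F := @objective R m h mu.

Definition forward_point z := z - tau *: G z.

Definition active_set z := [set i | theta < forward_point z 0 i]%SET.

Definition prox_point z := zero_outside (active_set z) (forward_point z).

(* The only features of an SGSN step that matter for convergence: the Newton
   direction enters through the two acceptance tests alone. *)
Definition safeguarded_step z z' := z' = prox_point z \/
  [/\ nonneg z', forall i, i \notin active_set z -> z' 0 i = 0,
      F z' + c1 * enorm (z' - prox_point z) ^+ 2 <= F (prox_point z)
    & enorm (subvec (active_set z) (G z')) <= c2 * enorm (z' - prox_point z)].

(** The two legs are added because the decrease of [F] controls each of them; the sum dominates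
    [|z' - z|]. *)
Definition step_length z z' := enorm (prox_point z - z) + enorm (z' - prox_point z).

Lemma theta_gt0 : 0 < theta.
Proof. by rewrite sqrtr_gt0 !mulr_gt0. Qed.

Lemma prox_pointP z i :
  prox_point z 0 i = 0 /\ forward_point z 0 i <= theta \/
  prox_point z 0 i = forward_point z 0 i /\ theta < forward_point z 0 i.
Proof.
by rewrite mxE inE; case: ltP => ?; [right|left].
Qed.

Lemma prox_point_ge0 z : nonneg (prox_point z).
Proof.
move=> i; case: (prox_pointP z i) => -[-> //] /(lt_trans theta_gt0) /ltW.
exact.
Qed.

Lemma step_ge0 z z' : safeguarded_step z z' -> nonneg z'.
Proof. by case=> [->|[]//]; exact: prox_point_ge0. Qed.

Lemma prox_pointE z : prox tau (g_fun mu) (forward_point z) (prox_point z).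
Proof.
apply: prox_hard_threshold => // i.
by case: (prox_pointP z i) => -[e H]; [left|right; split=> //; exact: ltW].
Qed.

Lemma prox_point_le z : nonneg z ->
  F (prox_point z) + (tau^-1 - L) / 2 * enorm (prox_point z - z) ^+ 2 <= F z.
Proof.
move=> z0; apply: (prox_sufficient_decrease smooth) => //.
  exact: prox_point_ge0.
exact: prox_pointE.
Qed.

Lemma step_le z z' : safeguarded_step z z' ->
  F z' + c1 * enorm (z' - prox_point z) ^+ 2 <= F (prox_point z).
Proof.
case=> [->|[]//]; rewrite subrr -(scale0r 0) enormZ normr0 mul0r.
by rewrite expr0n mulr0 addr0.
Qed.

(** The final halving pays for [(p + q)^2 <= 2 (p^2 + q^2)]. *)
Let kappa := Num.min ((tau^-1 - L) / 2) c1 / 2.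

Lemma kappa_gt0 : 0 < kappa.
Proof.
by rewrite divr_gt0// lt_min c1_gt0 divr_gt0// subr_gt0.
Qed.

Lemma step_decrease z z' : nonneg z -> safeguarded_step z z' ->
  F z' + kappa * step_length z z' ^+ 2 <= F z.
Proof.
move=> z0 zz'; have := prox_point_le _ z0; have := step_le _ _ zz'.
rewrite /step_length; set p := enorm (z' - _); set q := enorm _.
have k1 : kappa * 2 <= (tau^-1 - L) / 2 by rewrite divfK// ge_min lexx.
have k2 : kappa * 2 <= c1 by rewrite divfK// ge_min lexx orbT.
have k0 := kappa_gt0.
have : (q + p) ^+ 2 <= 2 * (q ^+ 2 + p ^+ 2) by have := sqr_ge0 (q - p); lra.
move/(ler_wpM2l (ltW k0)).
have := ler_wpM2r (sqr_ge0 p) k2; have := ler_wpM2r (sqr_ge0 q) k1; lra.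
Qed.

Lemma enorm_subvec (T : {set 'I_m}) u : enorm (subvec T u) = enorm (zero_outside T u).
Proof.
congr (Num.sqrt _); rewrite !big_ord1.
rewrite [RHS](bigID (fun i => i \in T))/= [X in _ = _ + X]big1 => [|i /negbTE iT].
  rewrite addr0 [RHS]big_enum_val/=; apply: eq_bigr => i _.
  by rewrite !mxE enum_valP.
by rewrite mxE iT expr0n.
Qed.

Lemma enorm_zero_outside (T : {set 'I_m}) u : enorm (zero_outside T u) <= enorm u.
Proof.
rewrite -(@ler_pXn2r _ 2) ?nnegrE ?enorm_ge0// !sqr_enorm !big_ord1.
by apply: ler_sum => i _; rewrite mxE; case: ifP; rewrite ?expr0n ?sqr_ge0.
Qed.

Let C := 2 * L + tau^-1 + c2.

(** For an accepted Newton point the gradient is cut to the active set and bounded by the second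
    test. For a proximal point [v], the vector [tau^-1 (z - v) - G z] vanishes on the active set, so
    it may be added to [G v] there; the result is small by the Lipschitz bound. *)
Lemma step_subgradient z z' : safeguarded_step z z' ->
  exists2 p : 'rV[R]_m, (forall i, z' 0 i != 0 -> p 0 i = G z' 0 i) &
    enorm p <= C * step_length z z'.
Proof.
have [L0 t0] := (L_gt0, tau_gt0); have c0 := c2_gt0.
have ti : 0 < tau^-1 by rewrite invr_gt0.
have n1 := enorm_ge0 _ _ (prox_point z - z).
have n2 := enorm_ge0 _ _ (z' - prox_point z).
case=> [z'E|[z'0 supp _ Gz']]; last first.
  exists (zero_outside (active_set z) (G z')) => [i zi|].
    by rewrite mxE; case: ifPn => // /supp zi0; rewrite zi0 eqxx in zi.
  rewrite -enorm_subvec; apply: le_trans Gz' _; rewrite /C /step_length; nra.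
exists (zero_outside (active_set z) (G z' - G z + tau^-1 *: (z - z'))).
  move=> i; rewrite z'E !mxE; case: ifP; rewrite ?eqxx// => _ _.
  by rewrite opprB [z 0 i + _]addrC subrK mulKf ?gt_eqF// subrK.
apply: le_trans (enorm_zero_outside _ _) _.
apply: le_trans (ler_enormD _ _) _.
rewrite enormZ gtr0_norm// (enormB z z').
have := gradient_lipschitz L_gt0 smooth z' z.
rewrite /C /step_length -z'E subrr -(scale0r 0) enormZ normr0 mul0r.
rewrite -z'E in n1; nra.
Qed.

(** Entries of proximal points are 0 or exceed [theta], and limits inherit a gap. Half of [theta]
    leaves room for perturbations on both sides. *)
Lemma accumulation_support w i :
  (forall e : R, 0 < e -> exists z, enorm (prox_point z - w) < e) ->
  w 0 i = 0 \/ theta / 2 < w 0 i.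
Proof.
have th0 := theta_gt0.
move=> acc; case: ltP => wi; [by right|left].
apply/eqP; rewrite -normr_le0; apply/ler_addgt0Pr => e e0; rewrite add0r.
have [|z zw] := acc (Num.min e (theta / 2)); first by rewrite lt_min e0 divr_gt0.
have := ler_enorm_coordB (prox_point z) w i => zi.
have [ze zt] : `|prox_point z 0 i - w 0 i| < e /\ `|prox_point z 0 i - w 0 i| < theta / 2.
  by split; apply: le_lt_trans zi (lt_le_trans zw _); rewrite ge_min lexx ?orbT.
case: (prox_pointP z i) => -[vi ui]; last first.
  by move: zt; rewrite ltr_norml vi => /andP[_]; lra.
by move: ze; rewrite vi sub0r normrN => /ltW.
Qed.

Lemma prox_point_support w z i : w 0 i = 0 \/ theta / 2 < w 0 i ->
  enorm (prox_point z - w) < theta / 2 ->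
  (prox_point z 0 i == 0) = (w 0 i == 0).
Proof.
have th0 := theta_gt0.
move=> wi zw; have := ler_enorm_coordB (prox_point z) w i.
move=> /le_lt_trans/(_ zw); rewrite ltr_norml => /andP[z1 z2].
case: wi => wi.
  rewrite wi eqxx; case: (prox_pointP z i) => -[vi ui]; first by rewrite vi eqxx.
  by exfalso; move: z1 z2; rewrite vi wi; lra.
rewrite !gt_eqF//; first lra.
by case: (prox_pointP z i) => -[vi ui]; move: z1 z2; rewrite vi; lra.
Qed.

Lemma forward_point_dist z w :
  enorm (forward_point z - forward_point w) <= (1 + 2 * L * tau) * enorm (z - w).
Proof.
have -> : forward_point z - forward_point w = (z - w) - tau *: (G z - G w).
  apply/rowP => i; rewrite !mxE; ring.
have [L0 t0] := (L_gt0, tau_gt0).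
apply: le_trans (ler_enormD _ _) _; rewrite enormN enormZ gtr0_norm//.
have := gradient_lipschitz L_gt0 smooth z w; have := enorm_ge0 _ _ (z - w); nra.
Qed.

(** The proximal map is discontinuous, so it cannot simply be passed to the limit. Near [w] the
    proximal points have the support of [w]; each coordinate thus stays in one thresholding
    alternative, whose relations survive in weak form. *)
Lemma accumulation_stationary w :
  (forall e : R, 0 < e ->
    exists z, enorm (z - w) < e /\ enorm (prox_point z - w) < e) ->
  prox tau (g_fun mu) (forward_point w) w.
Proof.
have [L0 t0] := (L_gt0, tau_gt0); have th0 := theta_gt0.
move=> acc; apply: prox_hard_threshold => // i; rewrite -/theta.
have supp : w 0 i = 0 \/ theta / 2 < w 0 i.
  apply: accumulation_support => e e0; have [z [_ ?]] := acc _ e0; by exists z.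
pose k := 1 + 2 * L * tau.
have k0 : 0 < k by rewrite ltr_wpDr// !mulr_ge0 ?ltW.
have near e : 0 < e -> exists z, [/\ (prox_point z 0 i == 0) = (w 0 i == 0),
    `|prox_point z 0 i - w 0 i| < e & `|forward_point z 0 i - forward_point w 0 i| < e].
  move=> e0; have [|z [zw vw]] := acc (Num.min (Num.min e (e / k)) (theta / 2)).
    by rewrite !lt_min e0 !divr_gt0.
  move: zw vw; rewrite !lt_min => /andP[/andP[_ ze] _] /andP[/andP[ve _] vt].
  exists z; split; first exact: prox_point_support.
    have := ler_enorm_coordB (prox_point z) w i => /le_lt_trans.
    exact.
  have := ler_enorm_coordB (forward_point z) (forward_point w) i.
  move=> /le_lt_trans; apply; apply: le_lt_trans (forward_point_dist _ _) _.
  by rewrite mulrC -ltr_pdivlMr.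
case: (eqVneq (w 0 i) 0) => [wi|wi]; [left|right].
  split=> //; apply/ler_addgt0Pr => e e0; have [z [zi _ +]] := near e e0.
  rewrite ltr_norml => /andP[+ _].
  have [[_]|[vi]] := prox_pointP z i; first lra.
  by move: zi; rewrite wi eqxx vi => /eqP ->; lra.
split.
  apply/eqP; rewrite -subr_eq0 -normr_le0; apply/ler_addgt0Pr => e e0.
  have [|z [zi]] := near (e / 2); first by rewrite divr_gt0.
  have [[vi _]|[-> _]] := prox_pointP z i.
    by move: zi; rewrite vi eqxx (negPf wi).
  rewrite !ltr_norml ler_norml => /andP[? ?] /andP[? ?]; apply/andP; split; lra.
apply/ler_addgt0Pr => e e0; have [z [zi _ +]] := near e e0.
rewrite ltr_norml => /andP[_ +].
have [[vi _]|[_]] := prox_pointP z i; last lra.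
by move: zi; rewrite vi eqxx (negPf wi).
Qed.

Lemma l0norm_prox_point w z :
  (forall i, w 0 i = 0 \/ theta / 2 < w 0 i) ->
  enorm (prox_point z - w) < theta / 2 -> l0norm (prox_point z) = l0norm w.
Proof.
move=> supp zw; apply: eq_card => i; rewrite !inE.
by rewrite (prox_point_support _ _ _ (supp i) zw).
Qed.

(** * Convergence of bounded feasible sequences of safeguarded steps *)

Section Convergence.
Variables (y : nat -> 'rV[R]_m) (M : R).
Hypotheses (y_ge0 : forall k, nonneg (y k))
  (y_step : forall k, safeguarded_step (y k) (y k.+1))
  (y_bounded : forall k, enorm (y k) <= M).

Let Delta k := step_length (y k) (y k.+1).

Lemma step_length_ge0 z z' : 0 <= step_length z z'.
Proof. by rewrite addr_ge0 ?enorm_ge0. Qed.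

Lemma objective_bounded_below k : h 0 - enorm (G 0) * M <= F (y k).
Proof.
have /andP[H _] := smooth 0 (y k).
have := cauchy_schwarz (- G 0) (y k); rewrite dotNl enormN => CS.
have := ler_wpM2l (enorm_ge0 _ _ (G 0)) (y_bounded k).
have : 0 <= mu * (l0norm (y k))%:R by rewrite mulr_ge0// ltW.
by rewrite subr0 in H; rewrite /F /objective; lra.
Qed.

Lemma objective_nonincreasing j k : (j <= k)%N -> F (y k) <= F (y j).
Proof.
move: j k; apply: homo_leq (fun=> lexx _) (fun _ _ _ a b => le_trans b a) _ => k.
apply: le_trans (step_decrease _ _ (y_ge0 k) (y_step k)).
by rewrite lerDl mulr_ge0 ?sqr_ge0// ltW// kappa_gt0.
Qed.

Lemma step_length_cvg0 : Delta @ \oo --> 0.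
Proof.
have Fcvg : cvgn (F \o y).
  apply: nonincreasing_is_cvgn => [j k|]; first exact: objective_nonincreasing.
  by exists (h 0 - enorm (G 0) * M) => _ [k _ <-]; exact: objective_bounded_below.
have dcvg : (fun k => F (y k) - F (y k.+1)) @ \oo --> 0.
  rewrite -(subrr (limn (F \o y))); apply: cvgB => //.
  by have := Fcvg; rewrite -cvg_shiftS.
apply/cvg_seq_distP => e e0; have k0 := kappa_gt0.
have ke : 0 < kappa * e ^+ 2 by rewrite mulr_gt0// exprn_gt0.
have [N NP] := (cvg_seq_distP _ _).1 dcvg _ ke.
exists N => k /NP; rewrite !subr0 => dk.
rewrite ger0_norm; last exact: step_length_ge0.
have D0 : 0 <= Delta k by exact: step_length_ge0.
rewrite -(@ltr_pXn2r _ 2) ?nnegrE ?(ltW e0)// -(ltr_pM2l k0).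
apply: le_lt_trans (le_lt_trans (ler_norm _) dk).
by have := step_decrease _ _ (y_ge0 k) (y_step k); rewrite /Delta; lra.
Qed.

(** Proximal points are included because their supports, unlike those of Newton points, are
    controlled near [w]. *)
Definition is_accumulation_point w := forall e : R, 0 < e -> forall N, exists k,
  [/\ (N <= k)%N, enorm (y k - w) < e & enorm (prox_point (y k) - w) < e].

Lemma accumulation_exists : exists w, is_accumulation_point w.
Proof.
have [w wP] := bounded_cluster _ _ y_bounded; exists w => e e0 N.
have e2 : 0 < e / 2 by rewrite divr_gt0.
have [N1 N1P] := (cvg_seq_distP _ _).1 step_length_cvg0 _ e2.
have [k] := wP _ e2 (maxn N N1); rewrite geq_max => /andP[Nk N1k] yw.
exists k; split=> //; first by lra.
have := N1P _ N1k; rewrite subr0 ger0_norm ?step_length_ge0//.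
have := ler_enormD (prox_point (y k) - y k) (y k - w); rewrite addrA subrK.
have := enorm_ge0 _ _ (y k.+1 - prox_point (y k)).
by rewrite /Delta /step_length; lra.
Qed.

Section AtAccumulationPoint.
Variable w : 'rV[R]_m.
Hypothesis y_acc : is_accumulation_point w.

Lemma accumulation_supp i : w 0 i = 0 \/ theta / 2 < w 0 i.
Proof.
apply: accumulation_support => e e0; have [k [_ _ ?]] := y_acc e e0 0%N.
by exists (y k).
Qed.

Lemma accumulation_ge0 : nonneg w.
Proof.
have th0 := theta_gt0.
by move=> i; case: (accumulation_supp i) => [->//|]; lra.
Qed.

Lemma accumulation_objective (e : R) : 0 < e -> forall N, exists2 k, (N <= k)%N &
  `|F (prox_point (y k)) - F w| < e.
Proof.
move=> e0 N; have th0 := theta_gt0; have L0 := L_gt0.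
pose K := enorm (G w) + L / 2.
have K0 : 0 < K by rewrite ltr_wpDl ?enorm_ge0// divr_gt0.
(* The cap 1 bounds the square by the distance, [e / K] controls [h], and [theta / 2] fixes the
   support, so that the l0 terms cancel. *)
pose d := Num.min (Num.min 1 (e / K)) (theta / 2).
have d0 : 0 < d by rewrite !lt_min ltr01 !divr_gt0.
have [k [Nk _ ]] := y_acc _ d0 N; rewrite !lt_min => /andP[/andP[v1 ve] vt].
exists k => //; rewrite /F /objective (l0norm_prox_point _ _ accumulation_supp vt).
rewrite opprD addrACA subrr addr0.
apply: le_lt_trans (smooth_dist L_gt0 smooth _ _) _.
rewrite ltr_pdivlMr// in ve.
have v0 := enorm_ge0 _ _ (prox_point (y k) - w).
have : L / 2 * enorm (prox_point (y k) - w) ^+ 2 <= L / 2 * enorm (prox_point (y k) - w).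
  by rewrite ler_pM2l ?divr_gt0// expr2 ler_piMr// ltW.
by move: ve; rewrite /K; lra.
Qed.

Lemma objective_prox_le k : F (prox_point (y k)) <= F (y k).
Proof.
apply: le_trans (prox_point_le _ (y_ge0 k)); rewrite lerDl mulr_ge0 ?sqr_ge0//.
by rewrite divr_ge0// subr_ge0 ltW.
Qed.

Lemma objective_le_prox k : F (y k.+1) <= F (prox_point (y k)).
Proof.
by apply: le_trans (step_le _ _ (y_step k)); rewrite lerDl mulr_ge0 ?sqr_ge0// ltW.
Qed.

Lemma accumulation_le k : F w <= F (y k).
Proof.
apply/ler_addgt0Pr => e e0; have [j kj] := accumulation_objective _ e0 k.
have := objective_nonincreasing _ _ kj; have := objective_prox_le j.
by rewrite ltr_norml => ? ? /andP[? ?]; lra.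
Qed.

(** Values at proximal points lie between consecutive values of [F] along [y]; monotonicity spreads
    their subsequential limit to the whole sequence. *)
Lemma objective_cvg : (fun k => F (y k) - F w) @ \oo --> 0.
Proof.
apply/cvg_seq_distP => e e0; have [j _ je] := accumulation_objective _ e0 0%N.
exists j.+1 => k jk; rewrite subr0 ger0_norm ?subr_ge0 ?accumulation_le//.
have := objective_nonincreasing _ _ jk; have := objective_le_prox j.
by move: je; rewrite ltr_norml => /andP[_ ?]; lra.
Qed.

Lemma PLK_cvg : PLK_at (@ereal_objective R m h mu) w -> y @ \oo --> w.
Proof.
case=> s [psi [s0 psiD]] /nbhs_enormP[rho rho0 KL].
pose r k := F (y k) - F w.
have r0 k : 0 <= r k by rewrite subr_ge0 accumulation_le.
have [K KP] : exists K, forall k, (K <= k)%N -> ((r k)%:E < s)%E.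
  case: s s0 {psiD KL} => [s||//] s0; last by exists 0%N => k _; rewrite ltry.
  have [N NP] := (cvg_seq_distP _ _).1 objective_cvg _ s0.
  exists N => k /NP; rewrite subr0 ger0_norm ?subr_ge0 ?accumulation_le//.
(* Dropping [K] terms keeps all remaining gaps [r k] in the domain of [psi]. *)
rewrite -(cvg_shiftn K).
have C0 : 0 < C.
  have [L0 c0] := (L_gt0, c2_gt0).
  have ti : 0 < tau^-1 by rewrite invr_gt0.
  rewrite /C; lra.
have k0 := kappa_gt0.
apply: (@cvg_of_finite_length _ _ _ w (fun k => Delta (k + K)%N)
  (fun k => psi (r (k + K)%N)) (C / kappa) rho 0).
- by rewrite divr_gt0.
- exact: rho0.
- move=> e e0 N; have [k [Nk yk _]] := y_acc _ e0 (N + K)%N.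
  exists (k - K)%N; first by rewrite leq_subRL ?(leq_trans (leq_addl _ _) Nk)// addnC.
  by rewrite /= subnK// (leq_trans (leq_addl _ _) Nk).
- move=> k; rewrite /= addSn.
  have := ler_enormD (y (k + K).+1 - prox_point (y (k + K)%N))
    (prox_point (y (k + K)%N) - y (k + K)%N).
  by rewrite addrA subrK [X in _ <= X -> _]addrC.
- by move=> k; case: psiD => _ _ + _ _; apply; split; [exact: r0 | apply: KP; exact: leq_addl].
- by rewrite (cvg_shiftn K Delta); exact: step_length_cvg0.
- apply: (desingularizing_cvg0 psiD (fun k => r (k + K)%N)) => //.
    by move=> k; apply: KP; exact: leq_addl.
  by rewrite (cvg_shiftn K r); exact: objective_cvg.
move=> k _; rewrite /= !addSn.
have Kk : (K <= k + K)%N by exact: leq_addl.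
move: (k + K)%N Kk => l Kl yl.
have dec := step_decrease _ _ (y_ge0 l.+1) (y_step l.+1).
have D0 : 0 <= Delta l by exact: step_length_ge0.
have D1 : 0 <= Delta l.+1 by exact: step_length_ge0.
have rs : ((r l.+1)%:E < s)%E by apply: KP; exact: leqW.
have rr : r l.+2 <= r l.+1 by rewrite lerD2r objective_nonincreasing.
split; first exact: (desingularizing_nondecreasing psiD).
have dec' : kappa * Delta l.+1 ^+ 2 <= r l.+1 - r l.+2.
  by rewrite /r /Delta; lra.
(* Without decrease the step has length 0. This case also absorbs [r l.+1 = 0], where the PLK
   inequality is silent. *)
have [req|rneq] := eqVneq (r l.+2) (r l.+1).
  rewrite req !subrr mulr0 in dec' *.
  by rewrite -(pmulr_rle0 _ k0).
have rlt : r l.+2 < r l.+1 by rewrite lt_neqAle rneq.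
have rp : 0 < r l.+1 by exact: le_lt_trans rlt.
have [p pG pC] := step_subgradient _ _ (y_step l).
have d0 : 0 < psi^`()%classic (r l.+1) by case: psiD => _ _ _ _ /(_ _ rp rs)[].
have tangent := desingularizing_tangent psiD _ _ (r0 l.+2) rlt rs.
(* The PLK inequality at [y l.+1], with the subgradient produced by the step that led there. *)
have kl : 1 <= psi^`()%classic (r l.+1) * (C * Delta l).
  rewrite -lee_fin EFinM; have := KL _ yl.
  rewrite !ereal_objective_fin//; last exact: accumulation_ge0.
  rewrite lte_fin -subr_gt0 -/(r _) => /(_ rp).
  have -> : ((F (y l.+1))%:E < (F w)%:E + s)%E.
    case: (s) rs => [s1||//] rs1; last by rewrite addey// ltry.
    by rewrite -EFinD lte_fin; rewrite lte_fin /r in rs1; lra.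
  move=> /(_ isT)/le_trans; apply; rewrite lee_pmul2l ?lte_fin//.
  apply: le_trans (dist0_objective mu_gt0 smooth _ _ (y_ge0 _) pG) _.
  by rewrite lee_fin.
have t1 : Delta l.+1 ^+ 2 <= (r l.+1 - r l.+2) / kappa.
  by rewrite ler_pdivlMr// mulrC.
apply: le_trans t1 _; rewrite ler_pdivrMr//.
have -> : C / kappa * Delta l * (psi (r l.+1) - psi (r l.+2)) * kappa =
    C * Delta l * (psi (r l.+1) - psi (r l.+2)).
  by field; rewrite gt_eqF.
have CD : 0 <= C * Delta l by rewrite mulr_ge0// ltW.
apply: le_trans (ler_wpM2l CD tangent).
have rr0 : 0 <= r l.+1 - r l.+2 by rewrite subr_ge0.
by have := ler_wpM2r rr0 kl; rewrite mul1r; lra.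
Qed.

End AtAccumulationPoint.

Theorem safeguarded_cvg : PLK_function (@ereal_objective R m h mu) ->
  exists w, y @ \oo --> w /\ prox tau (g_fun mu) (forward_point w) w.
Proof.
move=> plk; have [w acc] := accumulation_exists; exists w; split.
  (* [G w] is a subgradient at [w], so [w] lies in the domain of the limiting subdifferential. *)
  apply: PLK_cvg => //; apply: plk; exists (G w).
  apply: frechet_sub_limiting; apply: (frechet_subdiff_objective mu_gt0 smooth) => //.
  exact: accumulation_ge0.
apply: accumulation_stationary => e e0; have [k [_ ? ?]] := acc e e0 0%N.
by exists (y k).
Qed.

End Convergence.
End GradientProjection.

(** * Application to the SGSN algorithm *)

Lemma SGSN_step_safeguarded (R : realType) (m n : nat) (f : 'rV[R]_n -> R)
    (A : 'M[R]_(m, n)) (b : 'rV[R]_m) (mu tau c1 c2 gamma : R) (z z' : 'rV[R]_m) :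
  0 < mu -> 0 < tau -> SGSN_step f A b mu tau c1 c2 gamma z z' ->
  @safeguarded_step R m (h_fun f A b) (gradient (h_fun f A b)) mu tau c1 c2 z z'.
Proof.
move=> mu0 tau0 [H [d [_ _ ->]]].
set h := h_fun f A b; set G := gradient h.
rewrite -/(@forward_point R m G tau z) -/(@active_set R m G mu tau z).
rewrite -/(@prox_point R m G mu tau z); set T := active_set _; set v := prox_point _.
set zt := zero_outside _ _; case: ifP => [/andP[dF dG]|_]; last by left.
right; have v0 : nonneg v by exact: prox_point_ge0.
have FE w : F_fun f A b mu w = @ereal_objective R m h mu w by [].
have zt0 : nonneg zt.
  (* An infeasible [zt] would make [F v - F zt] equal to minus infinity and fail the first test. *)
  apply: contrapT => zt0; move: dF.
  by rewrite !FE (ereal_objective_pinfty _ zt0) (ereal_objective_fin _ v0).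
split=> // [i /negbTE iT|]; first by rewrite mxE iT.
move: dF; rewrite !FE !ereal_objective_fin// -EFinB lee_fin; lra.
Qed.

Theorem theorem16 (R : realType) (m n : nat) (sigma_f : R) (f : 'rV[R]_n -> R)
    (A : 'M[R]_(m, n)) (b : 'rV[R]_m) (mu tau c1 c2 gamma : R)
    (z : nat -> 'rV[R]_m)
    (sigma_f_gt0 : 0 < sigma_f) (f_sc : strongly_convex sigma_f f)
    (mu_gt0 : 0 < mu)
    (tau_gt0 : 0 < tau)
    (tau_lt : (tau%:E < ((enorm A ^+ 2 / sigma_f)%:E)^-1)%E)
    (c1_gt0 : 0 < c1) (c2_gt0 : 0 < c2) (gamma_gt0 : 0 < gamma)
    (z_SGSN : forall k, SGSN_step f A b mu tau c1 c2 gamma (z k) (z k.+1))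
    (z_bounded : exists M : R, forall k, enorm (z k) <= M)
    (F_PLK : PLK_function (F_fun f A b mu)) :
  exists zstar : 'rV[R]_m, z @ \oo --> zstar /\ P_stationary f A b mu zstar.
Proof.
pose l := enorm A ^+ 2 / sigma_f; pose h := h_fun f A b.
have l0 : 0 <= l by rewrite divr_ge0 ?sqr_ge0// ltW.
have lt : l < tau^-1.
  have [->|ln0] := eqVneq l 0; first by rewrite invr_gt0.
  have lp : 0 < l by rewrite lt_def ln0.
  move: tau_lt; rewrite -/l inver (negPf ln0) lte_fin => tl.
  by rewrite -[l]invrK ltf_pV2// posrE invr_gt0.
(* [L] is strictly positive even when [A = 0]. *)
pose L := (l + tau^-1) / 2.
have ti : 0 < tau^-1 by rewrite invr_gt0.
have [L0 Lt lL] : [/\ 0 < L, L < tau^-1 & l <= L] by split; rewrite /L; lra.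
have smooth u w : 0 <= h w - h u - dot (gradient h u) (w - u) <=
    L / 2 * enorm (w - u) ^+ 2.
  have /andP[-> /le_trans->//] := smooth_convex_bounds l0
    (fun x y t => h_fun_convex sigma_f_gt0 f_sc m A b x y t)
    (fun x y t => h_fun_semiconcave sigma_f_gt0 f_sc m A b x y t) u w.
  by rewrite ler_wpM2r ?sqr_ge0// ler_pM2r.
have step k := SGSN_step_safeguarded _ _ _ _ _ _ _ _ _ _ _ _ _ mu_gt0 tau_gt0 (z_SGSN k).
have [M zM] := z_bounded.
(* The sequence starts at [z 1]: the initial point is arbitrary, but every step ends in the
   nonnegative orthant. *)
have [w [zw wP]] := safeguarded_cvg L0 mu_gt0 tau_gt0 Lt c1_gt0 c2_gt0 smooth
  (fun k => z k.+1) M (fun k => step_ge0 mu_gt0 tau_gt0 _ _ (step k))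
  (fun k => step k.+1) (fun k => zM k.+1) F_PLK.
by exists w; split; [rewrite -cvg_shiftS | exists tau].
Qed.
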